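(* Let $E$ be a positive operator on a Hilbert space $\mathcal H$ with $\sigma(E)\subset[0,1]$. Let $(e_i)_{i\in I}$ be an orthonormal basis of $\mathcal H$ and define $\boldsymbol d=(d_i)_{i\in I}$ by $d_i=\langle Ee_i,e_i\rangle$. If $f_{\boldsymbol d}(\alpha)<\infty$ for some $\alpha\in(0,1)$, then $E$ is diagonalizable. Moreover, if $\boldsymbol\lambda=(\lambda_j)_{j\in I}$ is the eigenvalue list (with multiplicity) of $E$, then \[f_{\boldsymbol\lambda}(\alpha)\le f_{\boldsymbol d}(\alpha)\quad\text{for all }\alpha\in(0,1),\qquad f_{\boldsymbol d}'(\alpha)-f_{\boldsymbol\lambda}'(\alpha)\in\mathbb Z\quad\text{for a.e. }\alpha\in(0,1).\] In addition, \[\#|\{i:d_i=0\}|+\liminf_{\alpha\searrow0}\frac{f_{\boldsymbol d}(\alpha)-f_{\boldsymbol\lambda}(\alpha)}{\alpha}\ \ge\ \#|\{j:\lambda_j=0\}|\ \ge\ \#|\{i:d_i=0\}|,\] \[\#|\{i:d_i=1\}|+\liminf_{\alpha\nearrow1}\frac{f_{\boldsymbol d}(\alpha)-f_{\boldsymbol\lambda}(\alpha)}{1-\alpha}\ \ge\ \#|\{j:\lambda_j=1\}|\ \ge\ \#|\{i:d_i=1\}|.\]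
   Context: Hilbert spaces are separable. For a countable sequence $\boldsymbol d=(d_i)$ in $[0,1]$ and $\alpha\in(0,1)$, $f_{\boldsymbol d}(\alpha)=(1-\alpha)\sum_{d_i<\alpha}d_i+\alpha\sum_{d_i\ge\alpha}(1-d_i)\in[0,\infty]$. $\#|X|$ denotes the cardinality of $X$ (possibly $\infty$); the inequalities are in $[0,\infty]$. An operator is diagonalizable if the space has an orthonormal basis of its eigenvectors. *)

(* Defs.v *)
From HB Require Import structures.
From mathcomp Require Import all_boot all_order all_algebra.
From mathcomp Require Import sesquilinear complex.
From mathcomp Require Import all_classical all_reals all_analysis.
Import Order.TTheory GRing.Theory Num.Theory.
Import numFieldNormedType.Exports.

Set Implicit Arguments.
Unset Strict Implicit.
Unset Printing Implicit Defensive.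

Local Open Scope classical_set_scope.
Local Open Scope ring_scope.
Local Open Scope complex_scope.

(** Hilbert spaces are complex.  A Hilbert space is a complete normed module [V]
    over [R[i]] together with a positive definite hermitian form [dot] (linear
    in its first argument) inducing the norm; note that norms in [V] are
    themselves elements of [R[i]]. *)
Definition induces_norm (R : realType) (V : completeNormedModType R[i])
    (dot : {dot V for Num.conj}) : Prop :=
  forall x : V, `|x| ^+ 2 = dot x x.

Definition separable_space (V : topologicalType) : Prop :=
  exists2 D : set V, countable D & dense D.

Section HilbertSpace.
Variables (R : realType) (V : completeNormedModType R[i]).
Variable dot : {dot V for Num.conj}.

Definition linear_span (I : choiceType) (A : set I) (v : I -> V) : set V :=
  [set x | exists (s : seq I) (c : I -> R[i]),
     (forall i, i \in s -> A i) /\ x = \sum_(i <- s) c i *: v i].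

(** [(v i)_(i in A)] is an orthonormal basis of the closed subspace [W]; the
    values of [v] outside [A] are irrelevant. *)
Definition orthonormal_basis (I : choiceType) (W : set V) (A : set I)
    (v : I -> V) : Prop :=
  [/\ forall i, A i -> W (v i),
      forall i j, A i -> A j -> dot (v i) (v j) = (i == j)%:R
    & W `<=` closure (linear_span A v)].

(** In [R[i]], [0 <= z] means that [z] is a nonnegative real. *)
Definition positive_operator (E : {linear V -> V}) : Prop :=
  continuous E /\ forall x : V, 0 <= dot (E x) x.

Definition spectrum (E : {linear V -> V}) : set R[i] :=
  [set z | ~ exists G : {linear V -> V},
     [/\ continuous G,
         forall x, G (E x - z *: x) = x
       & forall x, E (G x) - z *: G x = x]].

Definition ker_eigen (E : {linear V -> V}) (mu : R[i]) : set V :=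
  [set x | E x = mu *: x].

Definition diagonalizable_operator (E : {linear V -> V}) : Prop :=
  exists (J : choiceType) (v : J -> V),
    orthonormal_basis [set: V] [set: J] v /\
    forall j, exists mu, ker_eigen E mu (v j).

(** Each [mu] occurs in [lam] exactly as many times as the (Hilbert) dimension
    of [ker (E - mu)]; numbers that are not eigenvalues have a trivial kernel
    and hence do not occur. *)
Definition eigenvalue_list (E : {linear V -> V}) (I : choiceType)
    (lam : I -> R[i]) : Prop :=
  forall mu : R[i], exists v : I -> V,
    orthonormal_basis (ker_eigen E mu) [set j | lam j = mu] v.

End HilbertSpace.

Definition fseq (R : realType) (I : choiceType) (d : I -> R) (alpha : R)
    : \bar R :=
  ((1 - alpha)%:E * (\esum_(i in [set i | (d i < alpha)%R]) (d i)%:E)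
   + alpha%:E * (\esum_(i in [set i | (alpha <= d i)%R]) (1 - d i)%:E))%E.

(** Derivative of an extended real-valued function: [f] is finite near [a] and
    differentiable there with derivative [l]. *)
Definition has_derivative (R : realType) (f : R -> \bar R) (a l : R) : Prop :=
  (\forall x \near a, f x \is a fin_num) /\ is_derive a (1 : R) (fine \o f) l.

(* Main.v *)
Require Import Defs.
From mathcomp Require Import all_boot all_order all_algebra.
From mathcomp Require Import sesquilinear complex.
From mathcomp Require Import all_classical all_reals all_analysis.
From mathcomp Require Import ring lra.
Import Order.TTheory GRing.Theory Num.Theory.
Import numFieldNormedType.Exports.
Local Open Scope classical_set_scope.
Local Open Scope ring_scope.
Local Open Scope complex_scope.
Set Implicit Arguments.
Unset Strict Implicit.
Unset Printing Implicit Defensive.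

(** Jensen's inequality for the concave function [t (1 - t)] bounds the trace of
    [K = E - E^2] by [\sum_i d_i (1 - d_i)], which is finite as soon as
    [f_d(alpha)] is.  A positive operator of finite trace has an eigenvector in
    every nonzero closed invariant subspace, and an eigenvector of [K] yields one
    of [E] because [E^2 - E + k] splits; hence [E] is diagonalizable.

    Let [v_j] be an eigenbasis with eigenvalues [lambda_j].  The matrix
    [p_ij = |<e_i, v_j>|^2] is doubly stochastic and maps [lambda] to [d].  With
    the tent function [g_a(t) = min ((1 - a) t, a (1 - t))] one has
    [f_d(a) = \sum_i g_a(d_i)], so Jensen for [g_a] gives [f_lambda <= f_d], and
    counting the mass that row [i] puts on [{lambda = 0}] gives the bounds at the
    endpoint [0]; the endpoint [1] follows by [t |-> 1 - t].

    Both functions are locally affine off a countable set.  With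
    [S = {d >= a}] and [T = {lambda >= a}], the difference of the derivatives
    is [b - c] where [c = \sum_(~S x T) p] and [b = \sum_(S x ~T) p].  Let [P], [Q]
    be the projections onto the spans of [(v_j)_T] and [(e_i)_S].  If [(u)] is an
    eigenbasis of [P (1 - Q) P] on the range of [P], with eigenvalues
    [1 - s_u], then the normalized [Q u] with [s_u <> 0], together with an
    orthonormal basis [Z] of [range Q /\ ker P], form an orthonormal basis of the
    range of [Q].  Computing [c] and [b] in these bases gives
    [c - b = #{s_u = 0} - #Z]. *)

(** * Inner product spaces *)

Section Modulus.
Variable R : realType.
Implicit Types (z w : R[i]).

(** Valued in [R] because the norm of [R[i]] is itself complex-valued; all estimates are carried out
    over the reals. *)
Definition sqmod z : R := complex.Re z ^+ 2 + complex.Im z ^+ 2.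

Lemma sqmod_ge0 z : 0 <= sqmod z.
Proof. by rewrite addr_ge0 ?sqr_ge0. Qed.

Lemma mulcJ z : z * z^*%C = (sqmod z)%:C.
Proof. by case: z => a b; apply/eqP; rewrite eq_complex /sqmod /=; apply/andP; split; apply/eqP; ring. Qed.

Lemma sqmodJ z : sqmod z^*%C = sqmod z.
Proof. by case: z => a b; rewrite /sqmod /=; ring. Qed.

Lemma sqmodR (r : R) : sqmod r%:C = r ^+ 2.
Proof. by rewrite /sqmod /=; ring. Qed.

Lemma sqmod0 : sqmod 0 = 0.
Proof. by rewrite /sqmod /=; ring. Qed.

Lemma sqmod_eq0 z : sqmod z = 0 -> z = 0.
Proof.
case: z => a b /eqP; rewrite /sqmod /= paddr_eq0 ?sqr_ge0// !sqrf_eq0.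
by move=> /andP[/eqP -> /eqP ->].
Qed.

Lemma ReM_real (r : R) z : complex.Re (r%:C * z) = r * complex.Re z.
Proof. by case: z => a b /=; ring. Qed.

Lemma Re_le_sqmod z : complex.Re z ^+ 2 <= sqmod z.
Proof. by rewrite /sqmod lerDl sqr_ge0. Qed.

Lemma Im_le_sqmod z : complex.Im z ^+ 2 <= sqmod z.
Proof. by rewrite /sqmod lerDr sqr_ge0. Qed.

End Modulus.

Section InnerProduct.
Variables (R : realType) (V : completeNormedModType R[i]).
Variable dot : {dot V for Num.conj}.
Implicit Types (x y z : V) (a : R[i]).

Definition sqnorm x : R := complex.Re (dot x x).
Local Notation q := sqnorm.

Lemma dotDl x y z : dot (x + y) z = dot x z + dot y z.
Proof. by rewrite linearDl. Qed.

Lemma dotDr x y z : dot x (y + z) = dot x y + dot x z.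
Proof. by rewrite linearDr. Qed.

Lemma dotZl a x y : dot (a *: x) y = a * dot x y.
Proof. by rewrite linearZl_LR. Qed.

Lemma dotZr a x y : dot x (a *: y) = a^*%C * dot x y.
Proof. by rewrite linearZr_LR. Qed.

Lemma dotC x y : dot y x = (dot x y)^*%C.
Proof. by rewrite hermC /= expr0 mul1r. Qed.

Lemma dot0l x : dot 0 x = 0.
Proof. by have := dotZl 0 0 x; rewrite scale0r mul0r. Qed.

Lemma dot0r x : dot x 0 = 0.
Proof. by rewrite dotC dot0l conjc0. Qed.

Lemma dotNl x y : dot (- x) y = - dot x y.
Proof. by rewrite -scaleN1r dotZl mulN1r. Qed.

Lemma dotNr x y : dot x (- y) = - dot x y.
Proof. by rewrite dotC dotNl rmorphN /= -dotC. Qed.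

Lemma dotBl x y z : dot (x - y) z = dot x z - dot y z.
Proof. by rewrite dotDl dotNl. Qed.

Lemma dotBr x y z : dot x (y - z) = dot x y - dot x z.
Proof. by rewrite dotDr dotNr. Qed.

Lemma dot_suml (I : Type) (s : seq I) (P : pred I) (F : I -> V) x :
  dot (\sum_(i <- s | P i) F i) x = \sum_(i <- s | P i) dot (F i) x.
Proof.
elim/big_rec2: _ => [|i u v _ <-]; first exact: dot0l.
by rewrite dotDl.
Qed.

Lemma dot_sqnorm x : dot x x = (q x)%:C.
Proof.
have := dotC x x; rewrite /q; case: (dot x x) => a b /= [] /eqP.
by rewrite -subr_eq0 opprK -mulr2n mulrn_eq0 /= => /eqP ->.
Qed.

Lemma sqnorm_ge0 x : 0 <= q x.
Proof. by rewrite -ler0c -dot_sqnorm; exact: dnorm_ge0. Qed.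

Lemma sqnorm_eq0 x : q x = 0 -> x = 0.
Proof. by move=> qx; apply/eqP; rewrite -(dnorm_eq0 dot) [X in X == _]dot_sqnorm qx. Qed.

Lemma sqnorm0 : q 0 = 0.
Proof. by rewrite /q dot0l. Qed.

Lemma sqnorm_gt0 x : x <> 0 -> 0 < q x.
Proof.
by move=> x0; rewrite lt_neqAle sqnorm_ge0 andbT eq_sym; apply/eqP => /sqnorm_eq0.
Qed.

Lemma sqnormZ a x : q (a *: x) = sqmod a * q x.
Proof. by rewrite /q dotZl dotZr mulrA mulcJ ReM_real. Qed.

Lemma sqnormN x : q (- x) = q x.
Proof. by rewrite /q dotNl dotNr opprK. Qed.

Lemma sqnormBC x y : q (x - y) = q (y - x).
Proof. by rewrite -sqnormN opprB. Qed.

Lemma ReJ a : complex.Re a^*%C = complex.Re a.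
Proof. by case: a. Qed.

Lemma ReD a b : complex.Re (a + b : R[i]) = complex.Re a + complex.Re b.
Proof. by case: a b => ? ? []. Qed.

Lemma ReN a : complex.Re (- a) = - complex.Re a.
Proof. by case: a. Qed.

Lemma ImD a b : complex.Im (a + b : R[i]) = complex.Im a + complex.Im b.
Proof. by case: a b => ? ? []. Qed.

Lemma ImN a : complex.Im (- a) = - complex.Im a.
Proof. by case: a. Qed.

Lemma sqnormD x y : q (x + y) = q x + 2 * complex.Re (dot x y) + q y.
Proof. by rewrite /q dotDl !dotDr !ReD (dotC x y) ReJ; ring. Qed.

Lemma sqnormB x y : q (x - y) = q x - 2 * complex.Re (dot x y) + q y.
Proof. by rewrite sqnormD dotNr ReN sqnormN mulrN. Qed.

Lemma sqnormD_le x y : q (x + y) <= 2 * q x + 2 * q y.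
Proof. by have := sqnorm_ge0 (x - y); rewrite sqnormB sqnormD; lra. Qed.

Lemma sqnormB_le x y z : q (x - z) <= 2 * q (x - y) + 2 * q (y - z).
Proof. by rewrite -(subrKA y x) sqnormD_le. Qed.

Hypothesis Vdot : induces_norm dot.

Lemma norm_sqnorm x : exists2 r : R, `|x| = r%:C & 0 <= r /\ q x = r ^+ 2.
Proof.
have := Vdot x; rewrite dot_sqnorm => nx.
have n0 : 0 <= `|x| by exact: normr_ge0.
exists (complex.Re `|x|); first by rewrite RRe_real// ger0_real.
move: n0 nx; case: `|x| => a b; rewrite lecE /= => /andP[/eqP -> a0] [qx _].
by split => //; rewrite -qx; ring.
Qed.

Lemma norm_lt (e : R) x : 0 < e -> (`|x| < e%:C) = (q x < e ^+ 2).
Proof.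
move=> e0; have [r -> [r0 ->]] := norm_sqnorm x.
by rewrite ltcR ltr_pXn2r// nnegrE ltW.
Qed.

Lemma posC (e : R[i]) : 0 < e -> exists2 r : R, 0 < r & e = r%:C.
Proof.
by case: e => a b; rewrite ltcE /= => /andP[/eqP -> a0]; exists a.
Qed.

Lemma ball_sqnorm x y (r : R) : 0 < r -> ball x r%:C y = (q (x - y) < r ^+ 2) :> Prop.
Proof.
by move=> r0; rewrite -norm_lt// -ball_normE.
Qed.

Lemma closure_sqnorm (A : set V) x :
  closure A x <-> forall e : R, 0 < e -> exists2 y, A y & q (x - y) < e.
Proof.
split => [cA e e0|H].
  have /cA [y [Ay]] : nbhs x (ball x (Num.sqrt e)%:C).
    by apply: nbhsx_ballx; rewrite ltcR sqrtr_gt0.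
  by rewrite ball_sqnorm ?sqrtr_gt0// sqr_sqrtr ?ltW//; exists y.
move=> B /nbhs_ballP[r /= /posC[r' r0 ->] rB].
have [y Ay qy] := H (r' ^+ 2) (exprn_gt0 _ r0).
by exists y; split => //; apply: rB; rewrite ball_sqnorm.
Qed.

(** Completeness of [V] in terms of the real squared norm, for arbitrary filters: it is applied to
    partial Fourier sums and to an ultrafilter of near maximizers. *)
Lemma sqnorm_complete (F : set_system V) : ProperFilter F ->
  (forall e : R, 0 < e -> exists2 A, F A &
     forall x y, A x -> A y -> q (x - y) < e) ->
  exists l, forall e : R, 0 < e -> F [set x | q (x - l) < e].
Proof.
move=> FF H.
have cF : cauchy F.
  apply: cauchy_exP => _ /posC[r r0 ->].
  have [A FA HA] := H (r ^+ 2) (exprn_gt0 _ r0).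
  have [x Ax] := filter_ex FA.
  exists x; apply: filterS FA => y Ay.
  by rewrite /= ball_sqnorm//; exact: HA.
have /cvg_ex[l Fl] : cvg F by exact: cauchy_cvg.
exists l => e e0.
have /Fl : nbhs l (ball l (Num.sqrt e)%:C).
  by apply: nbhsx_ballx; rewrite ltcR sqrtr_gt0.
apply: filterS => y; rewrite ball_sqnorm ?sqrtr_gt0// sqr_sqrtr ?ltW//.
by rewrite /= sqnormBC.
Qed.

(** Continuity at 0 bounds [q (T y)] by 1 on a ball of radius [r], and rescaling gives the constant
    [2 / r ^+ 2]. *)
Lemma continuous_sqnorm_bounded (T : {linear V -> V}) : continuous T ->
  exists2 C : R, 0 < C & forall x, q (T x) <= C * q x.
Proof.
move=> cT.
have /cT : nbhs (T 0) (ball (T 0) 1%:C) by apply: nbhsx_ballx; rewrite ltcR.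
move=> /nbhs_ballP[_ /= /posC[r r0 ->]] H.
have {}H y : q y < r ^+ 2 -> q (T y) < 1.
  move=> qy; have := H y; rewrite ball_sqnorm//= ball_sqnorm// linear0 !sub0r !sqnormN expr1n.
  exact.
have r20 : 0 < r ^+ 2 by rewrite exprn_gt0.
exists (2 / r ^+ 2); first by rewrite divr_gt0.
move=> x; have [->|/eqP x0] := eqVneq x 0.
  by rewrite linear0 sqnorm0 mulr0.
have qx := sqnorm_gt0 x0.
have c0 : 0 <= r ^+ 2 / (2 * q x) by rewrite divr_ge0 ?mulr_ge0 ?ltW.
(* Scaling by [c] brings [x] to squared norm [r ^+ 2 / 2], strictly inside the ball. *)
pose c := Num.sqrt (r ^+ 2 / (2 * q x)).
have := H (c%:C *: x); rewrite linearZ /= !sqnormZ sqmodR sqr_sqrtr//.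
have -> : r ^+ 2 / (2 * q x) * q x = r ^+ 2 / 2 by field; rewrite gt_eqF.
rewrite ltr_pdivrMr// mulr_natr mulr2n ltrDl => /(_ r20).
rewrite mulrAC ltr_pdivrMr ?mulr_gt0// mul1r => H1.
by rewrite mulrAC ler_pdivlMr// mulrC ltW.
Qed.

End InnerProduct.

(** * Orthonormal families *)

Section FiniteSums.
Variables (R : realType) (I : choiceType) (A : set I).
Implicit Types (f : I -> \bar R) (s : seq I).

Lemma esum_seq_ge f s : uniq s -> (forall i, i \in s -> A i) ->
  (\sum_(i <- s) f i <= \esum_(i in A) f i)%E.
Proof.
move=> us sA; apply: esum_ge; exists [set` s] => //.
by rewrite -fsbig_seq.
Qed.

Lemma esum_seq_le f (M : \bar R) :
  (forall s, uniq s -> (forall i, i \in s -> A i) -> (\sum_(i <- s) f i <= M)%E) ->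
  (\esum_(i in A) f i <= M)%E.
Proof.
move=> H; apply: ge_ereal_sup => _ [X [finX XA] <-].
rewrite fsbig_finite//; apply: H => [|i]; first exact: finmap.fset_uniq.
by rewrite in_fset_set// inE => /XA.
Qed.

Lemma esum_seq_gt f (x : \bar R) : (x < \esum_(i in A) f i)%E ->
  exists s, [/\ uniq s, forall i, i \in s -> A i & (x < \sum_(i <- s) f i)%E].
Proof.
move=> /ereal_sup_gt[_ [X [finX XA] <-]]; rewrite fsbig_finite// => xf.
exists (finmap.enum_fset (fset_set X)); split => // i.
by rewrite in_fset_set// inE => /XA.
Qed.

End FiniteSums.

Lemma exchange_esum (R : realType) (I J : choiceType) (A : set I) (B : set J)
    (a : I -> J -> \bar R) : (forall i j, A i -> B j -> (0 <= a i j)%E) ->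
  (\esum_(i in A) \esum_(j in B) a i j = \esum_(j in B) \esum_(i in A) a i j)%E.
Proof.
move=> a0; rewrite esum_esum// [RHS]esum_esum; last by move=> j i Bj Ai; exact: a0.
rewrite (reindex_esum (A `*`` fun=> B) _ (fun x => (x.2, x.1)))//; split => //=.
- by move=> [i j] [].
- by move=> [i1 j1] [i2 j2] _ _ [-> ->].
- by move=> [j i] [Bj Ai]; exists (i, j).
Qed.

(** * Closed subspaces and the Cauchy-Schwarz inequality *)

Section Subspaces.
Variables (R : realType) (V : completeNormedModType R[i]).
Variable dot : {dot V for Num.conj}.
Hypothesis Vdot : induces_norm dot.
Implicit Types (x y z : V) (W : set V).
Local Notation q := (sqnorm dot).

Definition closed_subspace W : Prop :=
  [/\ W 0, forall (a : R[i]) x y, W x -> W y -> W (a *: x + y)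
    & closure W `<=` W].

Lemma subspaceZ W a x : closed_subspace W -> W x -> W (a *: x).
Proof. by move=> [W0 WP _] Wx; rewrite -[X in W X]addr0; exact: WP. Qed.

Lemma subspaceB W x y : closed_subspace W -> W x -> W y -> W (x - y).
Proof. by move=> [W0 WP _] Wx Wy; rewrite addrC -scaleN1r; exact: WP. Qed.

Lemma closed_subspace_setT : closed_subspace setT.
Proof. by []. Qed.

Lemma closed_subspaceI W W' :
  closed_subspace W -> closed_subspace W' -> closed_subspace (W `&` W').
Proof.
move=> [W0 WP Wc] [W'0 W'P W'c]; split => //.
- by move=> a x y [Wx W'x] [Wy W'y]; split; [exact: WP|exact: W'P].
- by move=> x cx; split; [apply: Wc|apply: W'c]; apply: closureS x cx => y [].
Qed.

Lemma sqmodD_le (z w : R[i]) : sqmod (z + w) <= 2 * sqmod z + 2 * sqmod w.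
Proof.
case: z w => a b [c d]; rewrite /sqmod /=.
by have := sqr_ge0 (a - c); have := sqr_ge0 (b - d); nra.
Qed.

(* Cauchy-Schwarz for a symmetric [T] that is only known to be positive on the
   subspace [W]. *)
Lemma form_cauchy_schwarz W (T : V -> V) x y : closed_subspace W ->
  (forall x y, dot (T x) y = dot x (T y)) ->
  (forall x, W x -> 0 <= complex.Re (dot (T x) x)) -> W x -> W y ->
  sqmod (dot (T x) y) <= complex.Re (dot (T x) x) * complex.Re (dot (T y) y).
Proof.
move=> cW sT pT Wx Wy; set c := dot (T x) y.
(* Positivity of the form at [x - s c y], expanded in the real parameter [s]. *)
have key (s : R) : 0 <= complex.Re (dot (T x) x) - 2 * s * sqmod c
    + s ^+ 2 * sqmod c * complex.Re (dot (T y) y).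
  have /pT := subspaceB cW Wx (subspaceZ (s%:C * c) cW Wy).
  have cJ : dot y (T x) = c^*%C by rewrite -dotC.
  rewrite dotBr dotZr (sT _ x) (sT _ y) !dotBl !dotZl cJ -!sT -/c.
  have -> : dot (T y) y = (complex.Re (dot (T y) y))%:C.
    have := dotC dot (T y) y; rewrite -sT; case: (dot (T y) y) => a b /= [] /eqP.
    by rewrite -subr_eq0 opprK -mulr2n mulrn_eq0 /= => /eqP ->.
  rewrite !(ReD, ReN); move: (complex.Re (dot (T x) x)) (complex.Re (dot (T y) y)).
  have le u v : u = v -> u <= v :> R by move=> ->.
  case: (c) => a b e f H; apply: (le_trans H); apply: le.
  by rewrite /sqmod /=; ring.
have c0 := sqmod_ge0 c; have y0 := pT _ Wy; have x0 := pT _ Wx.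
(* If the form is nonzero at [y], its inverse there is the optimal [s]. Otherwise [key] is affine in
   [s], and a large [s] violates it unless [c] vanishes. *)
have [Ty0|/eqP Ty0] := eqVneq (complex.Re (dot (T y) y)) 0; last first.
  have {}y0 : 0 < complex.Re (dot (T y) y) by rewrite lt_neqAle y0 andbT eq_sym; exact/eqP.
  have := key (complex.Re (dot (T y) y))^-1.
  set t := complex.Re (dot (T y) y) in y0 *.
  have -> : complex.Re (dot (T x) x) - 2 * t^-1 * sqmod c + t^-1 ^+ 2 * sqmod c * t
     = complex.Re (dot (T x) x) - sqmod c / t by field; rewrite gt_eqF.
  by rewrite subr_ge0 ler_pdivrMr.
rewrite Ty0 mulr0 leNgt; apply/negP => c1.
have := key ((complex.Re (dot (T x) x) + 1) / (2 * sqmod c)).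
rewrite Ty0 mulr0 addr0.
have -> : 2 * ((complex.Re (dot (T x) x) + 1) / (2 * sqmod c)) * sqmod c
     = complex.Re (dot (T x) x) + 1 by field; rewrite gt_eqF.
by lra.
Qed.

Lemma cauchy_schwarz x y : sqmod (dot x y) <= q x * q y.
Proof.
exact: (@form_cauchy_schwarz setT idfun _ _ closed_subspace_setT _
  (fun x _ => sqnorm_ge0 dot x)).
Qed.

Lemma closure_ortho (A : set V) x y :
  (forall a, A a -> dot a y = 0) -> closure A x -> dot x y = 0.
Proof.
move=> Ay /(closure_sqnorm Vdot) cx; apply: sqmod_eq0; apply/eqP.
rewrite eq_le sqmod_ge0 andbT; apply/ler_addgt0Pr => e e0.
(* Dividing by [1 + q y] rather than [q y] covers [y = 0]. *)
have y1 : 0 < 1 + q y by rewrite ltr_pwDl// sqnorm_ge0.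
have [a Aa qa] := cx (e / (1 + q y)) (divr_gt0 e0 y1).
rewrite add0r -[x in dot x y](subrK a) dotDl (Ay _ Aa) addr0.
apply: (le_trans (cauchy_schwarz _ _)).
move: qa; rewrite ltr_pdivlMr// => qa.
by have := sqnorm_ge0 dot (x - a); nra.
Qed.

Definition orthocompl (A : set V) : set V := [set x | forall a, A a -> dot x a = 0].

Lemma orthocompl_sub (A : set V) : closed_subspace (orthocompl A).
Proof.
split=> [a _|a x y ox oy b Ab|x cx a Aa]; first by rewrite dot0l.
  by rewrite dotDl dotZl (ox _ Ab) (oy _ Ab) mulr0 addr0.
by apply: closure_ortho cx => b; exact.
Qed.

End Subspaces.

(** * Fourier sums, orthogonal projection and Parseval's identity *)

Section Fourier.
Variables (R : realType) (V : completeNormedModType R[i]).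
Variable dot : {dot V for Num.conj}.
Hypothesis Vdot : induces_norm dot.
Implicit Types (x y z : V) (W : set V).
Local Notation q := (sqnorm dot).

Lemma linear_span_sub W (J : choiceType) (B : set J) (u : J -> V) :
  closed_subspace W -> (forall i, B i -> W (u i)) -> linear_span B u `<=` W.
Proof.
move=> cW Wu _ [s [c [sB ->]]].
elim: s sB => [|i s IH] sB; first by rewrite big_nil; case: cW.
rewrite big_cons; case: (cW) => _ WP _; apply: WP.
  by apply/Wu/sB; rewrite mem_head.
by apply: IH => j js; apply: sB; rewrite inE js orbT.
Qed.

Lemma closure_span_sub W (J : choiceType) (B : set J) (u : J -> V) :
  closed_subspace W -> (forall i, B i -> W (u i)) ->
  closure (linear_span B u) `<=` W.
Proof.
move=> cW Wu x cx; case: (cW) => _ _; apply.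
by apply: closureS cx; exact: linear_span_sub.
Qed.

Lemma span_ortho (J : choiceType) (B : set J) (u : J -> V) x y :
  (forall i, B i -> dot (u i) y = 0) -> closure (linear_span B u) x -> dot x y = 0.
Proof.
move=> uy; apply: (closure_ortho Vdot) => _ [s [c [sB ->]]].
rewrite dot_suml big1_seq// => i /= /sB Bi.
by rewrite dotZl uy ?mulr0.
Qed.

Definition orthonormal_family (J : choiceType) (B : set J) (u : J -> V) : Prop :=
  forall i j, B i -> B j -> dot (u i) (u j) = (i == j)%:R.

Section Family.
Variables (I : choiceType) (A : set I) (v : I -> V).
Hypothesis ov : orthonormal_family A v.

Definition fourier_sum x (s : seq I) : V := \sum_(i <- s) dot x (v i) *: v i.
Local Notation psum := fourier_sum.
Local Notation coef2 x s := (\sum_(i <- s) sqmod (dot x (v i))).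

Section Sequence.
Variable s : seq I.
Hypotheses (us : uniq s) (sA : forall i, i \in s -> A i).

Lemma fourier_sum_span x : linear_span A v (psum x s).
Proof. by exists s, (fun i => dot x (v i)). Qed.

Lemma dot_fourier_sum x j : A j ->
  dot (psum x s) (v j) = if j \in s then dot x (v j) else 0.
Proof.
move=> Aj; rewrite dot_suml; case: ifPn => js.
  rewrite (bigD1_seq j)//= dotZl ov// eqxx mulr1 big1_seq ?addr0//.
  move=> i /andP[ij /= is_]; rewrite dotZl ov//; last exact: sA.
  by rewrite (negbTE ij) mulr0.
rewrite big1_seq// => i /= is_; rewrite dotZl ov//; last exact: sA.
by case: eqP => [ij|_]; [rewrite -ij is_ in js|rewrite mulr0].
Qed.

Lemma dot_fourier_rem x j : j \in s -> dot (x - psum x s) (v j) = 0.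
Proof. by move=> js; rewrite dotBl dot_fourier_sum ?js ?subrr//; exact: sA. Qed.

(** Pythagoras: the remainder is orthogonal to each [v i] with [i] in [s], hence to the partial
    sum. *)
Lemma sqnorm_fourier_rem x : q (x - psum x s) = q x - coef2 x s.
Proof.
have o1 : dot (x - psum x s) (psum x s) = 0.
  rewrite dotC dot_suml big1_seq ?conjc0// => i /= is_.
  by rewrite dotZl (dotC _ (x - _)) dot_fourier_rem// conjc0 mulr0.
have e1 : dot (psum x s) x = (coef2 x s)%:C.
  rewrite dot_suml rmorph_sum /=; apply: eq_bigr => i _.
  by rewrite dotZl (dotC _ x (v i)) mulcJ.
have e2 : dot (psum x s) (psum x s) = (coef2 x s)%:C.
  rewrite -e1; apply/eqP; rewrite eq_sym -subr_eq0 -dotBr.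
  by rewrite dotC o1 conjc0.
rewrite -[in RHS](subrK (psum x s) x) [in RHS]sqnormD o1 /=.
by rewrite {3}/sqnorm e2 subrK /= mulr0 addr0 addrK.
Qed.

Lemma bessel_seq x : coef2 x s <= q x.
Proof. by rewrite -subr_ge0 -sqnorm_fourier_rem sqnorm_ge0. Qed.

End Sequence.

Lemma sqmod_coef2 x s t : uniq s -> uniq t -> (forall i, i \in t -> A i) ->
  {subset s <= t} ->
  q (psum x t - psum x s) = coef2 x t - coef2 x s.
Proof.
move=> us ut tA st; have sA i : i \in s -> A i by move=> /st /tA.
have o1 : dot (x - psum x t) (psum x t - psum x s) = 0.
  rewrite dotC dotBl !dot_suml !big1_seq ?subr0 ?conjc0// => i /= it.
    by rewrite dotZl (dotC _ (x - _)) dot_fourier_rem// ?conjc0 ?mulr0//; exact: st.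
  by rewrite dotZl (dotC _ (x - _)) dot_fourier_rem// conjc0 mulr0.
have := sqnorm_fourier_rem us sA x.
rewrite -[x - psum x s](subrKA (psum x t)) [q (x - _ + _)]sqnormD o1 sqnorm_fourier_rem//= mulr0 addr0; lra.
Qed.

(** Let [S] be the supremum of the coefficient masses of finite partial sums. The sums of mass above
    [S - e] generate, as [e] decreases to 0, a Cauchy filter whose limit is the orthogonal
    projection of [x]. *)
Lemma fourier_projection x : exists2 y, closure (linear_span A v) y &
  forall i, A i -> dot (x - y) (v i) = 0.
Proof.
pose adm s := uniq s /\ forall i, i \in s -> A i.
pose S := sup [set coef2 x s | s in adm].
have nil_adm : adm [::] by [].
have hS : has_sup [set coef2 x s | s in adm].
  split; first by exists 0, [::] => //; rewrite big_nil.
  by exists (q x) => _ [s [us sA] <-]; exact: bessel_seq.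
have leS s : adm s -> coef2 x s <= S.
  by move=> ads; apply: ub_le_sup => //; [case: hS|exists s].
pose B e := [set psum x s | s in [set s | adm s /\ S - e < coef2 x s]].
have dist e s t : 0 < e -> adm s -> adm t -> S - e < coef2 x s ->
    S - e < coef2 x t -> q (psum x s - psum x t) <= 4 * e.
  (* Both sums are compared with the one over the union [w], whose mass is at most [S]. *)
  move=> e0 [us sA] [ut tA] Ss St; set w := undup (s ++ t).
  have aw : adm w.
    split; first exact: undup_uniq.
    by move=> i; rewrite mem_undup mem_cat => /orP[/sA|/tA].
  have sw : {subset s <= w} by move=> i is_; rewrite mem_undup mem_cat is_.
  have tw : {subset t <= w} by move=> i is_; rewrite mem_undup mem_cat is_ orbT.
  have := sqnormB_le dot (psum x s) (psum x w) (psum x t).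
  rewrite (sqnormBC _ (psum x s) (psum x w)); case: (aw) => uw wA.
  rewrite (sqmod_coef2 _ us uw wA sw) (sqmod_coef2 _ ut uw wA tw).
  by have := leS _ aw; lra.
have FB : ProperFilter (filter_from [set e : R | 0 < e] B).
  apply: filter_from_proper.
    apply: filter_from_filter; first by exists 1 => /=.
    move=> e1 f /= e0 f0; exists (Num.min e1 f) => /=; first by rewrite lt_min e0.
    move=> _ [s [ads Ss] <-]; split; exists s => //; split => //;
      apply: le_lt_trans Ss; rewrite lerD2l lerN2 ge_min lexx ?orbT//.
  move=> e /= e0; have [_ [s ads <-] Ss] := sup_adherent e0 hS.
  by exists (psum x s), s.
have [l Hl] : exists l, forall e : R, 0 < e ->
    filter_from [set e : R | 0 < e] B [set x | q (x - l) < e].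
  apply: (sqnorm_complete Vdot FB) => e e0.
  have e8 : 0 < e / 8 by rewrite divr_gt0.
  exists (B (e / 8)); first by exists (e / 8).
  move=> _ _ [s [ads Ss] <-] [t [adt St] <-].
  by apply: (le_lt_trans (dist _ _ _ e8 ads adt Ss St)); lra.
have near e : 0 < e -> exists s, [/\ adm s, S - e < coef2 x s & q (psum x s - l) < e].
  move=> e0; have [d /= d0 dB] := Hl _ e0.
  have m0 : 0 < Num.min e d by rewrite lt_min e0.
  have [_ [s ads <-] Ss] := sup_adherent m0 hS.
  exists s; split => //.
    by apply: le_lt_trans Ss; rewrite lerD2l lerN2 ge_min lexx.
  apply: (dB (psum x s)); exists s => //; split => //.
  by apply: le_lt_trans Ss; rewrite lerD2l lerN2 ge_min lexx orbT.
exists l.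
  apply/(closure_sqnorm Vdot) => e /near[s [[us sA] _ qs]].
  exists (psum x s); last by rewrite sqnormBC.
  exact: fourier_sum_span.
move=> i Ai; apply: sqmod_eq0; apply/eqP; rewrite eq_le sqmod_ge0 andbT.
apply/ler_addgt0Pr => e e0; have e4 : 0 < e / 4 by rewrite divr_gt0.
have [s [[us sA] Ss qs]] := near _ e4.
have -> : x - l = (x - psum x s) + (psum x s - l) by rewrite subrKA.
rewrite dotDl add0r; apply: (le_trans (sqmodD_le _ _)).
have := cauchy_schwarz dot (psum x s - l) (v i).
rewrite [q (v i)]/sqnorm ov// eqxx /= mulr1 => cs.
suff : sqmod (dot (x - psum x s) (v i)) <= e / 4 by lra.
have [is_|is_] := boolP (i \in s).
  by rewrite dot_fourier_rem// sqmod0 ltW.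
rewrite dotBl dot_fourier_sum// (negbTE is_) subr0.
(* Adjoining [i] to [s] raises the mass by the squared coefficient at [i], which is therefore at
   most the gap to [S]. *)
have /leS : adm (i :: s).
  split; first by rewrite /= is_.
  by move=> j; rewrite inE => /orP[/eqP ->|/sA].
by rewrite big_cons; lra.
Qed.

Lemma bessel x : (\esum_(i in A) (sqmod (dot x (v i)))%:E <= (q x)%:E)%E.
Proof.
by apply: esum_seq_le => s us sA; rewrite sumEFin lee_fin bessel_seq.
Qed.

(** The Fourier sum approximates [x] at least as well as any other combination of the same vectors,
    so density of the span closes the gap in Bessel's inequality. *)
Lemma parseval x : closure (linear_span A v) x ->
  (\esum_(i in A) (sqmod (dot x (v i)))%:E = (q x)%:E)%E.
Proof.
move=> /(closure_sqnorm Vdot) cx; apply/eqP; rewrite eq_le bessel/=.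
apply/lee_addgt0Pr => e e0; have [_ [s [c [sA ->]]] qs] := cx _ e0.
have us := undup_uniq s; have uA i : i \in undup s -> A i by rewrite mem_undup => /sA.
apply: le_trans (leeD2r _ (esum_seq_ge _ us uA)).
rewrite sumEFin -EFinD lee_fin -lerBlDl -sqnorm_fourier_rem//.
apply: le_trans (ltW qs); set y := \sum_(i <- s) _; set z := psum x _.
have o1 : dot (x - z) (z - y) = 0.
  rewrite dotC dotBl !dot_suml !big1_seq ?subr0 ?conjc0// => i /= is_.
    by rewrite dotZl (dotC _ (x - _)) dot_fourier_rem ?mem_undup// conjc0 mulr0.
  by rewrite dotZl (dotC _ (x - _)) dot_fourier_rem// conjc0 mulr0.
by rewrite -[x - y](subrKA z) [leRHS]sqnormD o1 /= mulr0 addr0 lerDl sqnorm_ge0.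
Qed.

(** The criterion used for every basis below: [x] minus its projection lies in [W] and is orthogonal
    to the family, hence is zero. *)
Lemma total_span W : closed_subspace W -> (forall i, A i -> W (v i)) ->
  (forall x, W x -> (forall i, A i -> dot x (v i) = 0) -> x = 0) ->
  W `<=` closure (linear_span A v).
Proof.
move=> cW Wv tot x Wx; have [y cy oy] := fourier_projection x.
have Wy : W y by exact: closure_span_sub cW Wv _ cy.
suff -> : x = y by [].
by apply/eqP; rewrite -subr_eq0; apply/eqP/tot => //; exact: subspaceB.
Qed.

Lemma span_total x : closure (linear_span A v) x ->
  (forall i, A i -> dot x (v i) = 0) -> x = 0.
Proof.
move=> cx ox; apply: (@sqnorm_eq0 _ _ dot); rewrite /sqnorm.
by rewrite (span_ortho _ cx)// => i Ai; rewrite dotC ox// conjc0.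
Qed.

End Family.

(** Zorn's lemma on subsets of [V]; a set of vectors is its own index set through [id], so unions of
    chains are again families. *)
Lemma maximal_orthonormal_set (P : set V) : exists A : set V,
  [/\ A `<=` P, orthonormal_family A id &
      forall x, P x -> dot x x = 1 -> (forall a, A a -> dot x a = 0) -> False].
Proof.
have [F FP Ftot|A [[AP oA] mA]] :=
    @Zorn_bigcup V [set A | A `<=` P /\ orthonormal_family A id].
  split; first by move=> x [A FA Ax]; have [AP _] := FP _ FA; exact: AP.
  move=> x y [A FA Ax] [B FB By].
  have [/(_ _ Ax) Bx|/(_ _ By) Ay] := Ftot _ _ FA FB.
    by have [_] := FP _ FB; apply.
  by have [_] := FP _ FA; apply.
exists A; split => // x Px qx ox.
have nAx : ~ A x by move=> /ox; rewrite qx => /eqP; rewrite oner_eq0.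
apply: (mA (A `|` [set x])).
  by split=> [y|/(_ x)]; [left|move=> H; apply/nAx/H; right].
split; first by move=> y [/AP //|->].
move=> y z [Ay|->] [Az|->] /=.
- exact: oA.
- by rewrite dotC ox// conjc0; case: eqP => // yx; rewrite -yx in nAx.
- by rewrite ox//; case: eqP => // yx; rewrite yx in nAx.
- by rewrite eqxx.
Qed.

End Fourier.

(** * Operators of finite trace *)

Lemma filter_all_seq (T : Type) (F : set_system T) (I : eqType) (s : seq I)
    (P : I -> T -> Prop) : Filter F -> (forall i, F (P i)) ->
  F [set x | forall i, i \in s -> P i x].
Proof.
move=> FF FP; elim: s => [|i s IH]; first by apply: filterE.
apply: filterS (filterI (FP i) IH) => x [Pi Ps] j.
by rewrite inE => /orP[/eqP ->|/Ps].
Qed.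

(** The limit is the supremum of the [r] for which [r <= f] holds on a member of [U]; above it, the
    ultrafilter must contain the complement. *)
Lemma ultra_cvg_bounded (R : realType) (T : Type) (U : set_system T) (f : T -> R)
    (C : R) : UltraFilter U -> U [set x | `|f x| <= C] ->
  exists r, forall e, 0 < e -> U [set x | `|f x - r| < e].
Proof.
move=> UU UC; have PU : ProperFilter U by exact: ultra_proper.
pose S := [set r | U [set x | r <= f x]].
have hS : has_sup S.
  split; first by exists (- C); apply: filterS UC => x /=; rewrite ler_norml => /andP[].
  exists C => r Sr; have [x [/= rx]] := filter_ex (filterI Sr UC).
  by rewrite ler_norml => /andP[_]; exact: le_trans.
exists (sup S) => e e0.
have [r Sr re] := sup_adherent e0 hS.
have nS : U (~` [set x | sup S + e <= f x]).
  have [Se|//] := in_ultra_setVsetC [set x | sup S + e <= f x] UU.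
  have : sup S + e <= sup S by apply: ub_le_sup Se; case: hS.
  by rewrite gerDl leNgt e0.
apply: filterS (filterI Sr nS) => x [/= rx /negP]; rewrite -ltNge ltr_norml => fe.
by apply/andP; split; lra.
Qed.

Lemma esum_tail (R : realType) (I : choiceType) (A : set I) (f : I -> \bar R) (e : R) :
  (forall i, A i -> (0 <= f i)%E) -> (\esum_(i in A) f i < +oo)%E -> 0 < e ->
  exists s : seq I, [/\ uniq s, forall i, i \in s -> A i
    & (\esum_(i in A `&` ~` [set` s]) f i < e%:E)%E].
Proof.
move=> f0 foo e0.
have ffin : (\esum_(i in A) f i)%E \is a fin_num by rewrite ge0_fin_numE// esum_ge0.
have /esum_seq_gt[s [us sA Hs]] : (\esum_(i in A) f i - e%:E < \esum_(i in A) f i)%E.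
  by rewrite lteBlDr// lteDl// lte_fin.
exists s; split => //; move: Hs; rewrite (esumID [set` s])// => Hs.
have sB : (\sum_(i <- s) f i <= \esum_(i in A `&` [set` s]) f i)%E.
  by apply: esum_seq_ge => // i is_; split => //; exact: sA.
move: ffin (lt_le_trans Hs sB); rewrite (esumID [set` s])//.
move: (\esum_(i in A `&` [set` s]) f i)%E (\esum_(i in A `&` ~` [set` s]) f i)%E.
move=> [a| |] [b| |] //= _; rewrite -!(EFinD, EFinN) !lte_fin; lra.
Qed.

Section Symmetric.
Variables (R : realType) (V : completeNormedModType R[i]).
Variable dot : {dot V for Num.conj}.
Hypothesis Vdot : induces_norm dot.
Implicit Types (x y z : V) (W : set V) (T : V -> V).
Local Notation q := (sqnorm dot).

(** [T] is a bare function: symmetry already forces linearity ([symD], [symZ]), so composites such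
    as [E - E^2] carry no further structure. *)
Definition symmetric_op T : Prop := forall x y, dot (T x) y = dot x (T y).
Definition qform T x : R := complex.Re (dot (T x) x).

Lemma dot_inj x y : (forall z, dot x z = dot y z) -> x = y.
Proof.
move=> H; apply/eqP; rewrite -subr_eq0; apply/eqP/(@sqnorm_eq0 _ _ dot).
by rewrite /sqnorm dotBl H subrr.
Qed.

Lemma normalize x : x <> 0 -> exists2 r : R, 0 < r & q (r%:C *: x) = 1.
Proof.
move=> /(sqnorm_gt0 dot) x0; exists (Num.sqrt (q x))^-1.
  by rewrite invr_gt0 sqrtr_gt0.
by rewrite sqnormZ sqmodR exprVn sqr_sqrtr ?ltW// mulVf// gt_eqF.
Qed.

Section Operator.
Variable T : V -> V.
Hypothesis sT : symmetric_op T.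
Local Notation t := (qform T).

Lemma symD x y : T (x + y) = T x + T y.
Proof. by apply: dot_inj => z; rewrite sT !dotDl !sT. Qed.

Lemma symZ (a : R[i]) x : T (a *: x) = a *: T x.
Proof. by apply: dot_inj => z; rewrite sT !dotZl sT. Qed.

Lemma symB x y : T (x - y) = T x - T y.
Proof. by rewrite -scaleN1r symD symZ scaleN1r. Qed.

Lemma dot_qform x : dot (T x) x = (t x)%:C.
Proof.
have := dotC dot (T x) x; rewrite /qform -sT; case: (dot (T x) x) => a b /= [] /eqP.
by rewrite -subr_eq0 opprK -mulr2n mulrn_eq0 /= => /eqP ->.
Qed.

Lemma qformZ a x : t (a *: x) = sqmod a * t x.
Proof. by rewrite /qform symZ dotZl dotZr mulrA mulcJ ReM_real. Qed.

(** Cauchy-Schwarz for the form of [T] at [x] and [T x] gives [q (T x) ^+ 2 <= t x * t (T x) <= t x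
    * C * q (T x)]; then divide by [q (T x)]. *)
Lemma qform_bound W (C : R) : closed_subspace W -> (forall x, W x -> W (T x)) ->
  0 <= C -> (forall x, W x -> 0 <= t x <= C * q x) ->
  forall x, W x -> q (T x) <= C * t x.
Proof.
move=> cW WT C0 tC x Wx; have t0 y : W y -> 0 <= t y by move=> /tC/andP[].
have := form_cauchy_schwarz cW sT t0 Wx (WT _ Wx).
rewrite dot_sqnorm sqmodR -/(t x) -/(t (T x)) => cs.
have [qT0|/eqP qT] := eqVneq (q (T x)) 0; first by rewrite qT0 mulr_ge0// t0.
have {}qT : 0 < q (T x) by rewrite lt_neqAle sqnorm_ge0 andbT eq_sym; exact/eqP.
have /andP[_ tT] := tC _ (WT _ Wx).
have : q (T x) * q (T x) <= C * t x * q (T x).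
  by have := ler_wpM2l (t0 _ Wx) tT; lra.
by rewrite ler_pM2r.
Qed.

Lemma qform_sup W (C : R) : closed_subspace W ->
  (forall x, W x -> q x = 1 -> t x <= C) -> (exists2 u, W u & q u = 1) ->
  exists M, (forall x, W x -> t x <= M * q x) /\
    (forall d, 0 < d -> exists x, [/\ W x, q x = 1 & M - d < t x]).
Proof.
move=> cW tC [u Wu qu]; pose N := [set t x | x in [set x | W x /\ q x = 1]].
have hN : has_sup N.
  split; first by exists (t u), u.
  by exists C => _ [x [Wx qx] <-]; exact: tC.
exists (sup N); split=> [x Wx|d d0]; last first.
  by have [_ [x [Wx qx] <-] tx] := sup_adherent d0 hN; exists x.
have [->|/eqP x00] := eqVneq x 0; first by rewrite /qform dot0r sqnorm0 mulr0.
have [r r1 qr] := normalize x00.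
have : t (r%:C *: x) <= sup N.
  by apply: ub_le_sup; [case: hN|exists (r%:C *: x) => //; split => //; exact: subspaceZ].
rewrite qformZ => trM.
move: qr; rewrite sqnormZ sqmodR => qr; rewrite sqmodR in trM.
have r2 : 0 < r ^+ 2 by rewrite exprn_gt0.
by rewrite -(ler_pM2l r2) mulrCA qr mulr1.
Qed.

Lemma sym_defect (M : R) : symmetric_op (fun x => M%:C *: x - T x).
Proof. by move=> x y; rewrite dotBl dotBr dotZl dotZr sT conjc_real. Qed.

End Operator.

(** This is [qform_bound] for [M - T]. It makes unit vectors with form close to [M] approximate
    eigenvectors for [M]. *)
Lemma qform_defect T W (M : R) : symmetric_op T -> closed_subspace W ->
  (forall x, W x -> W (T x)) -> 0 <= M ->
  (forall x, W x -> 0 <= qform T x <= M * q x) ->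
  forall x, W x -> q (M%:C *: x - T x) <= M * (M * q x - qform T x).
Proof.
move=> sT cW WT M0 tM x Wx.
have tT' y : qform (fun x => M%:C *: x - T x) y = M * q y - qform T y.
  by rewrite /qform dotBl dotZl ReD ReN ReM_real.
rewrite -tT'; apply: (qform_bound (sym_defect sT M) cW) => // y Wy.
  by apply: subspaceB => //; [exact: subspaceZ|exact: WT].
by rewrite tT' subr_ge0 lerBlDr lerDl andbC tM.
Qed.

Section TraceClass.
Variables (T : V -> V) (C : R).
Hypothesis sT : symmetric_op T.
Hypothesis C0 : 0 <= C.
Local Notation t := (qform T).
Hypothesis tC : forall x, 0 <= t x <= C * q x.
Variables (I : choiceType) (e : I -> V).
Hypothesis oe : orthonormal_family dot setT e.
Hypothesis te : (setT `<=` closure (linear_span setT e)).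
Hypothesis trT : (\esum_(i in setT) (t (e i))%:E < +oo)%E.

Lemma qform_boundT x : q (T x) <= C * t x.
Proof. by apply: (@qform_bound _ sT setT) => //; exact: closed_subspace_setT. Qed.

(** Compactness of [T] in the form of uniformly small tails: the squared coefficient of [T x] at
    [e i] equals that of [x] against [T (e i)], so it is at most [q x * C * t (e i)], summable
    uniformly over the unit ball. *)
Lemma trace_class_tail (eta : R) : 0 < eta -> exists s : seq I, uniq s /\
  forall x, q (T x) <= \sum_(i <- s) sqmod (dot (T x) (e i)) + q x * eta.
Proof.
move=> eta0.
have t0 x : 0 <= t x by case/andP: (tC x).
have C1 : 0 < C + 1 by rewrite ltr_pwDr.
have [s [us _ Hs]] := esum_tail (fun i _ => t0 (e i) : (0 <= (t (e i))%:E)%E) trT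
  (divr_gt0 eta0 C1).
exists s; split => // x; rewrite -lee_fin EFinD.
have cx : closure (linear_span setT e) (T x) by exact: te.
rewrite -(parseval Vdot oe cx) (esumID [set` s]); last by move=> *; exact: sqmod_ge0.
rewrite setTI; apply: leeD.
  rewrite esum_fset; last 2 first.
  - exact: finite_seq.
  - by move=> *; exact: sqmod_ge0.
  by rewrite -fsbig_seq// sumEFin.
have [q0|/eqP q0] := eqVneq (q x) 0.
  have -> : x = 0 by exact: sqnorm_eq0 q0.
  rewrite sqnorm0 mul0r esum1// => i _.
  have -> : T 0 = 0 by have := symZ sT 0 0; rewrite !scale0r.
  by rewrite dot0l sqmod0.
have {}q0 : 0 < q x by rewrite lt_neqAle sqnorm_ge0 andbT eq_sym; exact/eqP.
apply: esum_seq_le => u uu uA; rewrite sumEFin lee_fin.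
have Hu := le_lt_trans (esum_seq_ge (fun i => (t (e i))%:E) uu uA) Hs.
rewrite sumEFin lte_fin ltr_pdivlMr// in Hu.
apply: (@le_trans _ _ (q x * (C + 1) * \sum_(i <- u) t (e i))).
  rewrite mulr_sumr; apply: ler_sum => i _; rewrite sT.
  apply: (le_trans (cauchy_schwarz _ _ _)); rewrite -mulrA ler_pM2l//.
  by apply: (le_trans (qform_boundT _)); rewrite ler_wpM2r// lerDl.
by rewrite -mulrA ler_pM2l// mulrC ltW.
Qed.

(** Take an ultrafilter of unit vectors of [W] whose forms tend to the supremum [M]. The coordinates
    of [T x] converge along it, the uniform tails turn this into norm convergence, and since
    [M x - T x] tends to 0 with [M > 0] the vectors [x] converge too, to an eigenvector for [M]. *)
Lemma trace_class_eigenvector W x0 : closed_subspace W ->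
  (forall x, W x -> W (T x)) -> W x0 -> x0 <> 0 ->
  exists2 x, W x /\ x <> 0 & exists k : R, T x = k%:C *: x.
Proof.
move=> cW WT Wx0 /normalize[r0 _ q1]; set u := r0%:C *: x0 in q1.
have Wu : W u by exact: subspaceZ.
have t0 x : 0 <= t x by case/andP: (tC x).
have unit_neq0 x : q x = 1 -> x <> 0.
  by move=> qx x00; move: qx; rewrite x00 sqnorm0 => /eqP; rewrite eq_sym oner_eq0.
have [|M [tM adh]] := @qform_sup _ sT W C cW _ (ex_intro2 _ _ u Wu q1).
  by move=> x _ qx; case/andP: (tC x); rewrite qx mulr1.
(* In this case the form is zero at [u], so [T u = 0]. *)
have [M0|M0] := leP M 0.
  exists u; first by split => //; exact: unit_neq0.
  exists 0; rewrite scale0r; apply: (@sqnorm_eq0 _ _ dot).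
  apply/eqP; rewrite eq_le sqnorm_ge0 andbT.
  apply: (le_trans (qform_boundT _)) => //.
  by rewrite mulr_ge0_le0//; apply: le_trans M0; have := tM _ Wu; rewrite q1 mulr1.
pose T' x := M%:C *: x - T x.
have sT' : symmetric_op T' := sym_defect sT M.
have qT' x : W x -> q (T' x) <= M * (M * q x - t x).
  apply: (qform_defect sT cW WT (ltW M0)) => y Wy.
  by rewrite t0 tM.
pose B d := [set x | [/\ W x, q x = 1 & M - d < t x]].
have FB : ProperFilter (filter_from [set d : R | 0 < d] B).
  apply: filter_from_proper.
    apply: filter_from_filter; first by exists 1 => /=.
    move=> d1 d2 /= d10 d20; exists (Num.min d1 d2) => /=; first by rewrite lt_min d10.
    move=> x [Wx qx tx]; split; split => //;
      apply: le_lt_trans tx; rewrite lerD2l lerN2 ge_min lexx ?orbT//.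
  move=> d /= d0; exact: adh.
have [U [UU BU]] := ultraFilterLemma FB; have PU : ProperFilter U by exact: ultra_proper.
have UB d : 0 < d -> U (B d) by move=> d0; apply: BU; exists d.
(* Applied to the real and imaginary parts of the coordinates, which are bounded by [C + 1] on unit
   vectors. *)
have coord i (f : R[i] -> R) : (forall z : R[i], f z ^+ 2 <= sqmod z) ->
    exists r, forall d, 0 < d -> U [set x | `|f (dot (T x) (e i)) - r| < d].
  move=> fz; apply: (@ultra_cvg_bounded _ _ _ _ (C + 1)) => //.
  apply: filterS (UB _ ltr01) => x [_ qx _] /=.
  rewrite -ler_sqr ?nnegrE ?addr_ge0// real_normK ?num_real//.
  apply: (le_trans (fz _)); apply: (le_trans (cauchy_schwarz _ _ _)).
  rewrite [q (e i)]/sqnorm oe// eqxx mulr1.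
  apply: (le_trans (qform_boundT _)) => //.
  have /andP[_] := tC x; rewrite qx mulr1 => txC.
  apply: (le_trans (ler_wpM2l C0 txC)); rewrite -expr2 lerXn2r ?nnegrE ?addr_ge0//.
  by rewrite lerDl.
have /choice[re Hre] i := coord i (@complex.Re R) (@Re_le_sqmod R).
have /choice[im Him] i := coord i (@complex.Im R) (@Im_le_sqmod R).
have cauchyT d : 0 < d -> exists2 A, U A &
    forall x y, A x -> A y -> q (T x - T y) < d.
  (* Since [q (x - y) <= 4], the tail contributes at most [d / 4]. Real and imaginary parts differ
     by less than [2 * h], so each of the [size s] coordinates contributes at most [8 * h ^+ 2], in
     total less than [d / 2]. *)
  move=> d0; have d8 : 0 < d / 16 by rewrite divr_gt0.
  have [s [us Hs]] := trace_class_tail d8.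
  pose h2 := d / (16 * (size s).+1%:R).
  have h20 : 0 < h2 by rewrite divr_gt0// mulr_gt0.
  pose h := Num.sqrt h2.
  have h0 : 0 < h by rewrite sqrtr_gt0.
  have h2E : h ^+ 2 = h2 by rewrite sqr_sqrtr// ltW.
  exists (B 1 `&` [set x | forall i, i \in s ->
     `|complex.Re (dot (T x) (e i)) - re i| < h /\
     `|complex.Im (dot (T x) (e i)) - im i| < h]).
    apply: filterI; first exact: UB.
    apply: (@filter_all_seq _ U _ s (fun i x =>
        `|complex.Re (dot (T x) (e i)) - re i| < h /\
        `|complex.Im (dot (T x) (e i)) - im i| < h)) => i.
    by apply: filterI; [exact: Hre|exact: Him].
  move=> x y [[_ qx _] Hx] [[_ qy _] Hy]; rewrite -symB//.
  apply: (le_lt_trans (Hs _)).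
  have : q (x - y) <= 4.
    by have := sqnormB_le dot x 0 y; rewrite subr0 sub0r sqnormN qx qy; lra.
  have : \sum_(i <- s) sqmod (dot (T (x - y)) (e i)) <= \sum_(i <- s) 8 * h2.
    rewrite !big_seq; apply: ler_sum => i is_; have [x1 x2] := Hx _ is_; have [y1 y2] := Hy _ is_.
    rewrite symB// dotBl /sqmod !(ReD, ImD, ReN, ImN).
    move: x1 x2 y1 y2; rewrite !ltr_norml -h2E.
    by move=> /andP[? ?] /andP[? ?] /andP[? ?] /andP[? ?]; nra.
  rewrite big_const_seq count_predT iter_addr_0 -[_ *+ size s]mulr_natr.
  have -> : 8 * h2 * (size s)%:R = d / 2 - 8 * h2.
    rewrite /h2 -natr1; field.
    by rewrite nat1r pnatr_eq0.
  by move=> ? ?; nra.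
have [l Hl] : exists l, forall d : R, 0 < d -> U [set x | q (x - l) < d].
  apply: (sqnorm_complete Vdot PU) => d d0.
  have M2 : 0 < M ^+ 2 by rewrite exprn_gt0.
  have dM : 0 < d * M ^+ 2 / 4 by rewrite divr_gt0// mulr_gt0.
  have dM' : 0 < d * M / 16 by rewrite divr_gt0// mulr_gt0.
  have [A UA HA] := cauchyT _ dM.
  exists (A `&` B (d * M / 16)); first by apply: filterI => //; exact: UB.
  move=> x y [Ax [Wx qx tx]] [Ay [Wy qy ty]].
  (* The first bracket is small by [cauchyT], the second because both vectors are approximate
     eigenvectors; each takes half of [d * M ^+ 2]. *)
  have e1 : M%:C *: (x - y) = (T x - T y) + (T' x - T' y).
    by rewrite /T' scalerBr opprB addrCA !subrKA.
  have := sqnormD_le dot (T x - T y) (T' x - T' y).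
  rewrite -e1 sqnormZ sqmodR => H1.
  have H2 := sqnormB_le dot (T' x) 0 (T' y).
  rewrite subr0 sub0r sqnormN in H2.
  have H3 := HA _ _ Ax Ay.
  have := qT' _ Wx; have := qT' _ Wy; rewrite qx qy !mulr1 => H4 H5.
  rewrite -(ltr_pM2l M2).
  have : M * (M - t x) <= M * (d * M / 16) by rewrite ler_pM2l//; lra.
  have : M * (M - t y) <= M * (d * M / 16) by rewrite ler_pM2l//; lra.
  by move=> H6 H7; lra.
have near d : 0 < d -> exists2 x, B d x & q (x - l) < d.
  by move=> d0; have [x [Bx qx]] := filter_ex (filterI (UB _ d0) (Hl _ d0)); exists x.
have Wl : W l.
  case: cW => _ _; apply; apply/(closure_sqnorm Vdot) => d /near[x [Wx _ _] qx].
  by exists x => //; rewrite sqnormBC.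
exists l.
  split => // l0; have h0 : 0 < 2^-1 :> R by rewrite invr_gt0.
  have [x [_ qx _]] := near _ h0; rewrite l0 subr0 qx; lra.
exists M; apply/eqP; rewrite eq_sym -subr_eq0; apply/eqP/(@sqnorm_eq0 _ _ dot).
rewrite -/(T' l); apply/eqP; rewrite eq_le sqnorm_ge0 andbT.
apply/ler_addgt0Pr => d d0; rewrite add0r.
(* From [T' l = T' (l - x) + T' x] one gets [q (T' l) <= 2 * M ^+ 2 * q (l - x) + 2 * M * (M - t
   x)], hence this denominator. *)
have K0 : 0 < 2 * M ^+ 2 + 2 * M by rewrite addr_gt0// mulr_gt0// exprn_gt0.
have [x [Wx qx tx] qxl] := near _ (divr_gt0 d0 K0).
have := sqnormD_le dot (T' (l - x)) (T' x); rewrite -symD// subrK => H1.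
have Wlx := subspaceB cW Wl Wx.
have H2 := qT' _ Wlx; have H3 := qT' _ Wx; have H4 := t0 (l - x).
rewrite sqnormBC in H2; rewrite qx mulr1 in H3.
have M2 : 0 < M ^+ 2 by rewrite exprn_gt0.
move: qxl; rewrite -(ltr_pM2l M2) => H5.
have : M * (M - t x) <= M * (d / (2 * M ^+ 2 + 2 * M)) by rewrite ler_pM2l//; lra.
have : 0 <= M * t (l - x) by rewrite mulr_ge0// ltW.
have dE : d = 2 * (M ^+ 2 * (d / (2 * M ^+ 2 + 2 * M))) +
    2 * (M * (d / (2 * M ^+ 2 + 2 * M))) by field; rewrite gt_eqF.
by move=> H6 H7; move: dE H1 H2 H3 H5 H7; set k := d / _; lra.
Qed.

End TraceClass.
End Symmetric.

(** * Diagonalization of a positive contraction *)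

Section PositiveContraction.
Variables (R : realType) (V : completeNormedModType R[i]).
Variable dot : {dot V for Num.conj}.
Hypothesis Vdot : induces_norm dot.
Implicit Types (x y z : V).
Local Notation q := (sqnorm dot).

(** Take a maximal orthonormal set of eigenvectors in [W]. By symmetry its orthogonal complement in
    [W] is invariant, so a nonzero vector there would yield one more eigenvector. *)
Lemma eigen_total (T : V -> V) W : symmetric_op dot T -> closed_subspace W ->
  (forall x, W x -> W (T x)) ->
  (forall W' x0, closed_subspace W' -> W' `<=` W -> (forall x, W' x -> W' (T x)) ->
    W' x0 -> x0 <> 0 ->
    exists2 x, W' x /\ x <> 0 & exists mu : R[i], T x = mu *: x) ->
  exists A : set V, [/\ forall u, A u -> W u /\ exists mu : R[i], T u = mu *: u,
    orthonormal_family dot A id &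
    forall x, W x -> (forall u, A u -> dot x u = 0) -> x = 0].
Proof.
move=> sT cW WT eig.
have [A [AP oA mA]] :=
  maximal_orthonormal_set dot [set x | W x /\ exists mu : R[i], T x = mu *: x].
exists A; split => // x Wx ox; apply: contrapT => x0.
have cA : closed_subspace (W `&` orthocompl dot A).
  by apply: closed_subspaceI => //; exact: orthocompl_sub.
have TA y : (W `&` orthocompl dot A) y -> (W `&` orthocompl dot A) (T y).
  move=> [Wy oy]; split; first exact: WT.
  by move=> a Aa; have [_ [mu Ea]] := AP _ Aa; rewrite sT Ea dotZr oy ?mulr0.
have [y [[Wy oy] y0] [mu Ey]] := eig _ x cA (@subIsetl _ _ _) TA (conj Wx ox) x0.
have [r _ qr] := normalize dot y0.
apply: (mA (r%:C *: y)).
- by split; [exact: subspaceZ|exists mu; rewrite (symZ sT) Ey !scalerA mulrC].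
- by rewrite dot_sqnorm qr.
- by move=> a Aa; rewrite dotZl oy ?mulr0.
Qed.

Variable E : {linear V -> V}.
Hypothesis Epos : positive_operator dot E.
Local Notation t := (qform dot E).

(** Polarization: the form is real at [x + y] and at [x + i y], which settles the imaginary and the
    real part of the identity. *)
Lemma positive_sym : symmetric_op dot E.
Proof.
have [_ pE] := Epos.
have Im0 x : complex.Im (dot (E x) x) = 0 by exact: ger0_Im.
move=> x y; have := Im0 (x + y); have := Im0 (x + 'i%C *: y).
rewrite !linearD linearZ /= !(dotDl, dotDr, dotZl, dotZr) !ImD.
have := Im0 x; have := Im0 y; rewrite (dotC _ (E y) x).
case: (dot (E x) x) => a b; case: (dot (E y) y) => c d.
case: (dot (E x) y) => e f; case: (dot (E y) x) => g h /= -> -> H1 H2.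
by apply/eqP; rewrite eq_complex /=; apply/andP; split; apply/eqP; lra.
Qed.

Lemma positive_qform_ge0 x : 0 <= t x.
Proof.
by have [_ pE] := Epos; have := pE x; rewrite (dot_qform positive_sym) ler0c.
Qed.

Hypothesis Espec : forall z : R[i], spectrum E z -> 0 <= z <= 1.

(* The supremum [M] of the numerical range lies in the spectrum: on unit vectors
   where [t] is close to [M], [M - E] is small, so it has no bounded inverse. *)
Lemma contraction_qform_le x : t x <= q x.
Proof.
have [cE _] := Epos; have sE := positive_sym.
have [->|/eqP x0] := eqVneq x 0; first by rewrite /qform dot0r sqnorm0.
have [C C0 EC] := continuous_sqnorm_bounded Vdot cE.
have [r _ qr] := normalize dot x0.
have [|M [tM adh]] := @qform_sup _ _ _ _ sE setT (C + 1) (@closed_subspace_setT R V)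
  _ (ex_intro2 _ _ _ Logic.I qr).
  move=> y _ qy; rewrite -ler_sqr ?nnegrE ?positive_qform_ge0 ?(addr_ge0 (ltW C0))//.
  have := cauchy_schwarz dot (E y) y; rewrite (dot_qform sE) sqmodR qy mulr1.
  have := EC y; rewrite qy mulr1 => h1 h2; apply: (le_trans h2); apply: (le_trans h1).
  by have := sqr_ge0 C; nra.
have [M1|M1] := leP M 1.
  by apply: (le_trans (tM _ Logic.I)); rewrite ler_piMl ?sqnorm_ge0.
have M0 : 0 < M by exact: lt_trans ltr01 M1.
suff /Espec /andP[_] : spectrum E M%:C by rewrite lecE /= => /andP[_]; rewrite leNgt M1.
move=> [G [cG GE _]].
have [D D0 GD] := continuous_sqnorm_bounded Vdot cG.
have DM : 0 < D * M by rewrite mulr_gt0.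
(* With [M - t y < 1 / (D * M)], a bounded inverse would give [1 = q y <= D * M * (M - t y) < 1]. *)
have [y [_ qy ty]] := adh _ (divr_gt0 ltr01 DM).
have := GD (E y - M%:C *: y); rewrite GE sqnormBC qy.
have /(_ y Logic.I) := qform_defect sE (@closed_subspace_setT R V) (fun _ _ => Logic.I)
  (ltW M0) (fun z _ => introT andP (conj (positive_qform_ge0 z) (tM z Logic.I))).
rewrite qy mulr1 -(ler_pM2l D0) => h1 h2.
have := le_trans h2 h1; rewrite mulrA => h3.
move: ty; rewrite ltrBlDr -ltrBlDl -(ltr_pM2l DM) mul1r mulfV ?gt_eqF//; lra.
Qed.

Variables (I : choiceType) (e : I -> V).
Hypothesis oe : orthonormal_family dot setT e.
Hypothesis te : (setT `<=` closure (linear_span setT e)).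
Hypothesis trE : (\esum_(i in setT) (t (e i) * (1 - t (e i)))%:E < +oo)%E.

(** This is [E^2 <= E], the case [C = 1] of [qform_bound]; it makes [E - E^2] positive. *)
Lemma contraction_sqnorm_le x : q (E x) <= t x.
Proof.
have := @qform_bound _ _ _ _ positive_sym setT 1 (@closed_subspace_setT R V).
move=> /(_ (fun _ _ => Logic.I) ler01) H; have := H _ x Logic.I; rewrite mul1r; apply.
by move=> y _; rewrite positive_qform_ge0 mul1r contraction_qform_le.
Qed.

Lemma contraction_eigenvector W x0 : closed_subspace W ->
  (forall x, W x -> W (E x)) -> W x0 -> x0 <> 0 ->
  exists2 x, W x /\ x <> 0 & exists mu : R[i], E x = mu *: x.
Proof.
move=> cW WE Wx0 x00; have sE := positive_sym.
pose K x := E x - E (E x).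
have sK : symmetric_op dot K by move=> x y; rewrite /K dotBl dotBr !sE.
have tK x : qform dot K x = t x - q (E x).
  by rewrite /qform /K dotBl ReD ReN (sE (E x)).
have tK1 x : 0 <= qform dot K x <= 1 * q x.
  rewrite tK mul1r subr_ge0 contraction_sqnorm_le lerBlDr.
  by rewrite (le_trans (contraction_qform_le _))// lerDl sqnorm_ge0.
(* By Cauchy-Schwarz [q (E (e i)) >= t (e i) ^+ 2], so the trace of [K] is dominated by the sum in
   [trE]. *)
have trK : (\esum_(i in setT) (qform dot K (e i))%:E < +oo)%E.
  apply: le_lt_trans trE; apply: le_esum => i _; rewrite lee_fin tK mulrBr mulr1.
  rewrite lerD2l lerN2; have := cauchy_schwarz dot (E (e i)) (e i).
  by rewrite (dot_qform sE) sqmodR [q (e i)]/sqnorm oe// eqxx mulr1 expr2.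
have WK x : W x -> W (K x) by move=> Wx; apply: subspaceB => //; [exact: WE|exact/WE/WE].
have [x [Wx xN0] [k Kx]] :=
  trace_class_eigenvector Vdot sK ler01 tK1 oe te trK cW WK Wx0 x00.
(* [E] satisfies [E^2 - E + k = 0] on [x], and this polynomial splits. *)
pose s : R[i] := sqrtc (4^-1 - k%:C).
pose a : R[i] := 2^-1 + s; pose b : R[i] := 2^-1 - s.
have ab1 : a + b = 1 by rewrite /a /b; field.
have abk : a * b = k%:C.
  have := sqr_sqrtc (4^-1 - k%:C); rewrite -/s => s2.
  have -> : a * b = 4^-1 - s ^+ 2 by rewrite /a /b; field.
  by rewrite s2; ring.
have [y0|/eqP y0] := eqVneq (E x - b *: x) 0.
  by exists x => //; exists b; apply/eqP; rewrite -subr_eq0 y0.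
exists (E x - b *: x).
  by split => //; apply: subspaceB => //; [exact: WE|exact: subspaceZ].
exists a; rewrite linearB linearZ /= scalerBr scalerA abk -Kx /K.
have -> : a = 1 - b by rewrite -ab1 addrK.
by rewrite [(1 - b) *: _]scalerBl scale1r opprB [RHS]addrC subrKA.
Qed.

Lemma contraction_diagonalizable : diagonalizable_operator dot E.
Proof.
have sE := positive_sym.
have [A [AP oA A0]] := eigen_total sE (@closed_subspace_setT R V) (fun _ _ => Logic.I)
  (fun W' x0 cW' _ WE Wx0 => contraction_eigenvector cW' WE Wx0).
exists A, val; split; last by move=> [x Ax] /=; rewrite inE in Ax; case: (AP _ Ax).
have oJ : orthonormal_family dot [set: A] val.
  by move=> [x Ax] [y Ay] _ _; rewrite oA// -?val_eqE//; apply: set_mem.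
split => //.
apply: (total_span Vdot oJ) => // x _ ox; apply: A0 => // a Aa.
by rewrite -(ox (exist _ a (mem_set Aa)) Logic.I).
Qed.

End PositiveContraction.

(** * Integrality of the essential codimension *)

Section CountingSum.
Variables (R : realType) (I : choiceType).

Lemma esum_cst1 (A : set I) : (\esum_(i in A) 1 = counting A :> \bar R)%E.
Proof.
rewrite /counting; case: asboolP => finA.
  rewrite esum_fset//= fsbig_finite//= sumEFin big_const_seq count_predT.
  by rewrite iter_addr_0.
apply/eqyP => r r0; have [n /ltW rn] : exists n, (r < n%:R).
  by exists (Num.bound r); exact/archi_boundP/ltW.
have [B BA nB] := infinite_set_fset n finA.
apply: (@le_trans _ _ (\sum_(i <- finmap.enum_fset B) 1%E)); last first.
  by apply: esum_seq_ge => // i iB; exact: BA.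
rewrite sumEFin big_const_seq count_predT iter_addr_0 lee_fin.
by apply: (le_trans rn); rewrite ler_nat.
Qed.

Lemma counting_int (A : set I) : (counting A < +oo :> \bar R)%E ->
  exists n : nat, counting A = n%:R%:E :> \bar R.
Proof. by rewrite /counting; case: asboolP => // _ _; eexists. Qed.

End CountingSum.

(** * Orthogonal projections onto spans of basis vectors *)

Section Projector.
Variables (R : realType) (V : completeNormedModType R[i]).
Variable dot : {dot V for Num.conj}.
Hypothesis Vdot : induces_norm dot.
Implicit Types (x y z : V).
Local Notation q := (sqnorm dot).

Definition projector (P : V -> V) : Prop :=
  symmetric_op dot P /\ forall x, P (P x) = P x.

Section Laws.
Variable P : V -> V.
Hypothesis pP : projector P.

(** The range of [P] is the orthogonal complement of the range of [1 - P], and orthogonal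
    complements are closed. *)
Lemma projector_range : closed_subspace [set x | P x = x].
Proof.
have [sP PP] := pP.
rewrite (_ : [set x | P x = x] = orthocompl dot [set y - P y | y in setT]).
  exact: orthocompl_sub.
apply/seteqP; split=> x /=.
  by move=> Px _ [y _ <-]; rewrite dotBr -sP Px subrr.
move=> ox; apply: (@dot_inj _ _ dot) => y; apply/eqP; rewrite eq_sym -subr_eq0.
by rewrite sP -dotBr; apply/eqP/ox; exists y.
Qed.

Lemma dot_projector x : dot (P x) x = (q (P x))%:C.
Proof. by have [sP PP] := pP; rewrite -{1}PP sP dot_sqnorm. Qed.

Lemma sqnorm_projectorB x : q (x - P x) = q x - q (P x).
Proof.
have [sP PP] := pP; rewrite sqnormB dotC dot_projector ReJ /=; ring.
Qed.

Lemma sqnorm_projector_le x : q (P x) <= q x.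
Proof. by rewrite -subr_ge0 -sqnorm_projectorB sqnorm_ge0. Qed.

End Laws.

Variables (I : choiceType) (v : I -> V).
Hypothesis ov : orthonormal_family dot setT v.
Hypothesis tv : setT `<=` closure (linear_span setT v).

(** Choice turns [fourier_projection] into a map; it is symmetric because [dot (P x) y] and
    [dot x (P y)] both equal [dot (P x) (P y)]. The formula on the complement of [A] is Parseval
    minus the formula on [A]. *)
Lemma span_projector (A : set I) : exists P, [/\ projector P,
  forall x, (\esum_(i in A) (sqmod (dot x (v i)))%:E = (q (P x))%:E)%E,
  forall x, (\esum_(i in ~` A) (sqmod (dot x (v i)))%:E = (q (x - P x))%:E)%E,
  forall i, A i -> P (v i) = v i
  & forall i, ~ A i -> P (v i) = 0].
Proof.
have oA : orthonormal_family dot A v by move=> i j _ _; exact: ov.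
have /choice[P HP] x : exists y, closure (linear_span A v) y /\
    forall i, A i -> dot (x - y) (v i) = 0.
  by have [y cy oy] := fourier_projection Vdot oA x; exists y.
have cP x : closure (linear_span A v) (P x) by case: (HP x).
have oP x y : closure (linear_span A v) y -> dot y (x - P x) = 0.
  apply: (span_ortho Vdot) => i Ai; have [_ o] := HP x.
  by rewrite dotC o// conjc0.
have sP : symmetric_op dot P.
  move=> x y; have /eqP := oP y _ (cP x); rewrite dotBr subr_eq0 => /eqP ->.
  have /(congr1 conjc) := oP x _ (cP y); rewrite -dotC conjc0 dotBl => /eqP.
  by rewrite subr_eq0 => /eqP ->.
have fP x : closure (linear_span A v) x -> P x = x.
  move=> cx; apply/eqP; rewrite eq_sym -subr_eq0; apply/eqP/(@sqnorm_eq0 _ _ dot).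
  by rewrite /sqnorm dotBl !oP// subrr.
have pP : projector P by split => // x; exact: fP.
have PvA i : A i -> P (v i) = v i.
  move=> Ai; apply: fP; apply: subset_closure; exists [:: i], (fun=> 1).
  by split; [move=> j; rewrite inE => /eqP ->|rewrite big_seq1 scale1r].
have H1 x : (\esum_(i in A) (sqmod (dot x (v i)))%:E = (q (P x))%:E)%E.
  rewrite -(parseval Vdot oA (cP x)); apply: eq_esum => i Ai.
  by rewrite sP PvA.
exists P; split => // [x|i nAi].
  have cx : closure (linear_span setT v) x by exact: tv.
  have := parseval Vdot ov cx; rewrite (esumID A); last by move=> *; exact: sqmod_ge0.
  rewrite !setTI H1 sqnorm_projectorB// => /eqP.
  case: (esum _ _) => [r| |]//; rewrite -EFinD eqe => /eqP <-.
  by rewrite addrAC subrr add0r.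
apply: (@sqnorm_eq0 _ _ dot); apply: EFin_inj; rewrite -H1 esum1// => j Aj.
by rewrite ov//; case: eqP => [ij|_]; [rewrite ij in nAi|rewrite sqmod0].
Qed.

End Projector.

(** * Integrality for a pair of projections *)

Section Kadison.
Variables (R : realType) (V : completeNormedModType R[i]).
Variable dot : {dot V for Num.conj}.
Hypothesis Vdot : induces_norm dot.
Implicit Types (x y z u : V).
Local Notation q := (sqnorm dot).
Variables (I J : choiceType) (e : I -> V) (v : J -> V).
Hypotheses (oe : orthonormal_family dot setT e) (ov : orthonormal_family dot setT v).
Hypothesis te : setT `<=` closure (linear_span setT e).
Hypothesis tv : setT `<=` closure (linear_span setT v).

(** Here [a] is the trace of [P (1 - Q) P] and [b] that of [Q (1 - P) Q]. An eigenvector [u] with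
    [s_u <> 0] and its normalized image under [Q] contribute the same [1 - s_u] to both, so only the
    vectors of [range P] killed by [Q] and those of [range Q] killed by [P] survive in [a - b], each
    counting 1. *)
Lemma kadison_integer (S : set I) (T : set J) (a b : R) :
  (\esum_(i in ~` S) \esum_(j in T) (sqmod (dot (e i) (v j)))%:E = a%:E)%E ->
  (\esum_(i in S) \esum_(j in ~` T) (sqmod (dot (e i) (v j)))%:E = b%:E)%E ->
  exists k : int, a - b = k%:~R.
Proof.
move=> aE bE.
have [P [pP PT PTc Pv Pv0]] := span_projector Vdot ov tv T.
have [Q [pQ QS QSc Qe Qe0]] := span_projector Vdot oe te S.
have [sP PP] := pP; have [sQ QQ] := pQ.
have sqJ x y : sqmod (dot x y) = sqmod (dot y x) by rewrite dotC sqmodJ.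
have p0 x y : (0 <= (sqmod (dot x y))%:E :> \bar R)%E by exact: sqmod_ge0.
pose D x := P x - P (Q (P x)).
have sD : symmetric_op dot D.
  by move=> x y; rewrite /D dotBl dotBr !sP sQ sP.
have tD x : qform dot D x = q (P x - Q (P x)).
  by rewrite /qform /D dotBl ReD ReN (sP (Q _)) !dot_projector// sqnorm_projectorB.
have tD1 x : 0 <= qform dot D x <= 1 * q x.
  rewrite tD sqnorm_ge0 mul1r sqnorm_projectorB//.
  by rewrite lerBlDr (le_trans (sqnorm_projector_le pP x))// lerDl sqnorm_ge0.
have trD : (\esum_(j in setT) (qform dot D (v j))%:E < +oo)%E.
  rewrite (esumID T); last by move=> j _; case/andP: (tD1 (v j)).
  rewrite !setTI [X in (_ + X)%E]esum1 ?adde0; last first.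
    by move=> j Tj; rewrite tD Pv0// (_ : Q 0 = 0) ?subrr ?sqnorm0//;
      rewrite -(scale0r 0) (symZ sQ) !scale0r.
  rewrite (_ : esum _ _ = a%:E) ?ltry// -aE exchange_esum//.
  apply: eq_esum => j Tj; rewrite tD Pv// -QSc; apply: eq_esum => i _.
  by rewrite sqJ.
pose W := [set x | P x = x].
have cW : closed_subspace W by exact: projector_range.
have WD x : W x -> W (D x).
  by move=> Wx; apply: subspaceB => //; rewrite /W /= PP.
have [A [AW oA tA]] := eigen_total Vdot sD cW WD (fun W' x0 cW' _ WE Wx0 x00 =>
  let: ex_intro2 y Wy (ex_intro k Ky) :=
    trace_class_eigenvector Vdot sD ler01 tD1 ov tv trD cW' WE Wx0 x00 in
  ex_intro2 _ _ y Wy (ex_intro _ k%:C Ky)).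
have PA u : A u -> P u = u by move=> /AW[].
have qA u : A u -> q u = 1 by move=> Au; rewrite /sqnorm oA// eqxx.
(* These are the [s_u]: [D u = (1 - sg u) u], equivalently [P (Q u) = sg u u]. *)
pose sg u := q (Q u).
have sg0 u : 0 <= sg u by exact: sqnorm_ge0.
have sgA u : A u -> P (Q u) = (sg u)%:C *: u.
  move=> Au; have [_ [mu Du]] := AW _ Au.
  have muE : mu = (1 - sg u)%:C.
    have := dot_qform sD u; rewrite Du dotZl dot_sqnorm qA// mulr1 => ->.
    by rewrite tD PA// sqnorm_projectorB// qA.
  move: Du; rewrite /D PA// muE rmorphB /= scalerBl scale1r.
  by move=> /addrI /oppr_inj.
have WA : W `<=` closure (linear_span A id).
  by apply: (total_span Vdot oA) => // u /PA.
(* Exchanging the sums and applying Parseval on both sides recomputes the trace [a] in the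
   eigenbasis [A]. *)
have aA : (\esum_(u in A) (1 - sg u)%:E = a%:E)%E.
  rewrite -aE.
  under eq_esum => u Au do rewrite -(qA _ Au) -(sqnorm_projectorB pQ) -QSc.
  rewrite exchange_esum//; apply: eq_esum => i _.
  rewrite PT; have WPi : closure (linear_span A id) (P (e i)) by apply: WA; exact: PP.
  rewrite -(parseval Vdot oA WPi); apply: eq_esum => u Au.
  by rewrite sqJ sP PA.
pose W2 := [set y | Q y = y /\ P y = 0].
have [Z [ZW2 oZ mZ]] := maximal_orthonormal_set dot W2.
pose r u := (Num.sqrt (sg u))^-1.
pose w u := (r u)%:C *: Q u.
(* One family indexed by vectors: [u] in [A] stands for [w u], and [z] in [Z] for itself. This is
   consistent because [A] and [Z] are disjoint. *)
pose f x := if x \in A then w x else x.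
pose B0 := A `&` [set u | sg u != 0].
pose N := A `&` ~` [set u | sg u != 0].
have r2 u : B0 u -> r u ^+ 2 * sg u = 1.
  by move=> [_ /= s0]; rewrite exprVn sqr_sqrtr// mulVf.
have nAZ z : Z z -> ~ A z.
  move=> Zz Az; have [_ Pz] := ZW2 _ Zz; have := oA _ _ Az Az.
  by rewrite -{1}(PA _ Az) Pz dot0l eqxx => /eqP; rewrite eq_sym oner_eq0.
have fB u : B0 u -> f u = w u by move=> [Au _]; rewrite /f mem_set.
have fZ z : Z z -> f z = z by move=> /nAZ nAz; rewrite /f memNset.
have Qw u : Q (w u) = w u by rewrite /w (symZ sQ) QQ.
have Pw u : A u -> P (w u) = (r u * sg u)%:C *: u.
  by move=> Au; rewrite /w (symZ sP) sgA// scalerA -rmorphM.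
have ww u u' : B0 u -> B0 u' -> dot (w u) (w u') = (u == u')%:R.
  move=> Bu [Au' _]; case: (Bu) => Au _; rewrite /w dotZl dotZr sQ QQ -sQ.
  rewrite -[X in dot _ X](PA _ Au') -sP sgA// dotZl oA//.
  case: eqP => [<-|_]; last by rewrite !mulr0.
  by rewrite mulr1 conjc_real -!rmorphM /= mulrA -expr2 r2.
have wz u z : B0 u -> Z z -> dot (w u) z = 0.
  move=> [Au _] /ZW2[Qz Pz].
  by rewrite /w dotZl sQ Qz -(PA _ Au) sP Pz dot0r mulr0.
have B0Z x : B0 x -> Z x -> False by move=> [Ax _] /nAZ.
have of_ : orthonormal_family dot (B0 `|` Z) f.
  move=> x y [Bx|Zx] [By|Zy].
  - by rewrite !fB// ww.
  - rewrite fB// fZ// wz//; case: eqP => // xy.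
    by rewrite xy in Bx; case: (B0Z y).
  - rewrite fZ// fB// dotC wz// conjc0; case: eqP => // xy.
    by rewrite xy in Zx; case: (B0Z y).
  - by rewrite !fZ// oZ.
have Qf x : (B0 `|` Z) x -> Q (f x) = f x.
  by move=> [Bx|Zx]; [rewrite fB// Qw|rewrite fZ//; case: (ZW2 _ Zx)].
have cQ : closed_subspace [set y | Q y = y] by exact: projector_range.
(* A vector [y] of the range of [Q] orthogonal to the family is orthogonal to all of [A], so
   [P y = 0] and [y] lies in [W2]; maximality of [Z] forces [y = 0]. *)
have tf : [set y | Q y = y] `<=` closure (linear_span (B0 `|` Z) f).
  apply: (total_span Vdot of_ cQ) => // y /= Qy oy.
  have yA u : A u -> dot y u = 0.
    move=> Au; rewrite -Qy sQ; have [s0|s0] := eqVneq (sg u) 0.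
      by rewrite (sqnorm_eq0 s0) dot0r.
    have Bu : B0 u by [].
    have := oy _ (or_introl Bu); rewrite fB// /w dotZr conjc_real => /eqP.
    rewrite mulf_eq0 => /orP[|/eqP //]; rewrite eq_complex /= eqxx andbT => /eqP r0.
    by have := r2 _ Bu; rewrite r0 expr0n mul0r => /eqP; rewrite eq_sym oner_eq0.
  have Py : P y = 0.
    have cPy : closure (linear_span A id) (P y) by apply: WA; exact: PP.
    by apply: (span_total Vdot cPy) => u Au; rewrite sP PA// yA.
  apply: contrapT => y0; have [c _ qy] := normalize dot y0.
  apply: (mZ (c%:C *: y)).
  - by split; rewrite ?(symZ sQ) ?(symZ sP) ?Qy ?Py ?scaler0.
  - by rewrite dot_sqnorm qy.
  - by move=> z Zz; rewrite dotZl -(fZ _ Zz) oy ?mulr0//; right.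
(* The trace [b] recomputed in the basis [f] of the range of [Q]: [w u] contributes [1 - sg u] and
   each [z] contributes 1. *)
have bE2 : (\esum_(u in B0) (1 - sg u)%:E + \esum_(z in Z) 1 = b%:E)%E.
  rewrite -bE; transitivity (\esum_(j in ~` T) (q (Q (v j)))%:E)%E; last first.
    rewrite exchange_esum//; apply: eq_esum => j _; rewrite -QS.
    by apply: eq_esum => i _; rewrite sqJ.
  transitivity (\esum_(x in B0 `|` Z) (q (f x - P (f x)))%:E)%E; last first.
    under eq_esum => x _ do rewrite -PTc.
    rewrite exchange_esum//; apply: eq_esum => j _.
    have cQj : closure (linear_span (B0 `|` Z) f) (Q (v j)) by apply: tf; exact: QQ.
    rewrite -(parseval Vdot of_ cQj); apply: eq_esum => x Bx.
    by rewrite sqJ sQ Qf.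
  rewrite (esumID B0 (B0 `|` Z)); last by move=> *; exact: sqnorm_ge0.
  have -> : (B0 `|` Z) `&` B0 = B0.
    by apply/seteqP; split=> x; [case|move=> Bx; split => //; left].
  have -> : (B0 `|` Z) `&` ~` B0 = Z.
    apply/seteqP; split=> x; first by move=> [[|]].
    by move=> Zx; split; [right|move=> /B0Z; exact].
  congr (_ + _)%E; apply: eq_esum => x.
    move=> Bx; case: (Bx) => Ax _; rewrite fB// sqnorm_projectorB// Pw//.
    rewrite {1}/w !sqnormZ !sqmodR -/(sg x) r2// qA// mulr1 exprMn.
    by rewrite [sg x ^+ 2]expr2 mulrA r2// mul1r.
  move=> Zx; have [_ Px] := ZW2 _ Zx.
  by rewrite fZ// Px subr0 /sqnorm oZ// eqxx.
move: aA; rewrite (esumID [set u | sg u != 0]); last first.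
  move=> u Au; rewrite lee_fin subr_ge0 -(qA _ Au).
  exact: sqnorm_projector_le.
rewrite -/B0 -/N; have -> : (\esum_(u in N) (1 - sg u)%:E = \esum_(u in N) 1)%E.
  by apply: eq_esum => u [_ /= /negP]; rewrite negbK => /eqP ->; rewrite subr0.
move: bE2; rewrite !esum_cst1.
have ge0 : (0 <= \esum_(u in B0) (1 - sg u)%:E)%E.
  apply: esum_ge0 => u [Au _]; rewrite lee_fin subr_ge0 -(qA _ Au).
  exact: sqnorm_projector_le.
(* Since [a] and [b] are real, the common sum over [B0] and both counts must be finite before
   anything is cancelled. *)
move: ge0; case: (esum _ _) => [s| |]// _; last first.
  by rewrite addye// -ltNye (lt_le_trans (ltNyr 0))//; rewrite -esum_cst1 esum_ge0.
have [Zoo|Zoo] := ltP (counting Z : \bar R) +oo%E; last first.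
  by move: Zoo; rewrite leye_eq => /eqP ->.
have [Noo|Noo] := ltP (counting N : \bar R) +oo%E; last first.
  by move: Noo; rewrite leye_eq => /eqP ->.
have [n ->] := counting_int Noo; have [m ->] := counting_int Zoo.
rewrite -!EFinD => -[<-] [<-]; exists (n%:Z - m%:Z).
by rewrite intrD intrN -!pmulrn opprD addrACA subrr add0r.
Qed.

End Kadison.

(** * The function [f_d] *)

Section Sums.
Variables (R : realType) (I : choiceType).
Implicit Types (A : set I) (f g : I -> R).

Lemma esumZ A (c : R) f : 0 <= c ->
  (\esum_(i in A) (c * f i)%:E = c%:E * \esum_(i in A) (f i)%:E)%E.
Proof.
rewrite le_eqVlt => /orP[/eqP <-|c0].
  by rewrite mul0e esum1// => i _; rewrite mul0r.
have Z X : finite_set X ->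
    (\sum_(i \in X) (c * f i)%:E = c%:E * \sum_(i \in X) (f i)%:E)%E.
  by move=> finX; rewrite !fsbig_finite// !sumEFin -EFinM mulr_sumr.
rewrite [in RHS]/esum -ereal_sup_pZl//; congr ereal_sup; apply/seteqP; split=> x.
  move=> [X XA <-]; exists (\sum_(i \in X) (f i)%:E)%E; first by exists X.
  by rewrite Z//; case: XA.
by move=> [_ [X XA <-] <-]; exists X => //; rewrite Z//; case: XA.
Qed.

(** Each index of the set contributes at least [c], so infinitely many would make the sum
    infinite. *)
Lemma esum_finite_ge A f (c : R) : (forall i, A i -> 0 <= f i) -> 0 < c ->
  (\esum_(i in A) (f i)%:E < +oo)%E -> finite_set (A `&` [set i | c <= f i]).
Proof.
move=> f0 c0 foo; apply: contrapT; set B := A `&` _ => inf.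
have : (\esum_(i in B) (c * 1)%:E < +oo)%E.
  apply: le_lt_trans foo; rewrite [leRHS](esumID [set i | c <= f i])//.
  apply: (@le_trans _ _ (\esum_(i in B) (f i)%:E)%E).
    by apply: le_esum => i [_ /= ci]; rewrite mulr1 lee_fin.
  by rewrite leeDl//; apply: esum_ge0 => i [/f0].
rewrite esumZ ?ltW// esum_cst1 /counting; case: asboolP => // _.
by rewrite mulry gtr0_sg// mul1e ltxx.
Qed.

End Sums.

Section Tent.
Variable R : realType.
Implicit Types (a t : R).

(** The summand of [fseq] (see [fseq_tent]); its two branches agree at [t = a], and [tentE] exhibits
    it as a minimum of two affine functions, hence concave. *)
Definition tent a t := if t < a then (1 - a) * t else a * (1 - t).

Lemma tentE a t : tent a t = Num.min ((1 - a) * t) (a * (1 - t)).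
Proof.
rewrite /tent; case: ltP => ta; [rewrite min_l//|rewrite min_r//]; nra.
Qed.

Lemma tent_le_left a t : tent a t <= (1 - a) * t.
Proof. by rewrite tentE ge_min lexx. Qed.

Lemma tent_le_right a t : tent a t <= a * (1 - t).
Proof. by rewrite tentE ge_min lexx orbT. Qed.

Lemma tent_sym a t : tent (1 - a) (1 - t) = tent a t.
Proof. by rewrite !tentE !subKr minC. Qed.

Lemma tent_ge0 a t : 0 < a < 1 -> 0 <= t <= 1 -> 0 <= tent a t.
Proof. by move=> /andP[a0 a1] /andP[t0 t1]; rewrite /tent; case: ifP => _; nra. Qed.

(** Dominates [t (1 - t)] by a tent, so that finiteness of [fseq] bounds the trace of [E - E^2]. *)
Lemma tent_ge a t : 0 < a < 1 -> 0 <= t <= 1 -> a * (1 - a) * (t * (1 - t)) <= tent a t.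
Proof.
move=> /andP[a0 a1] /andP[t0 t1].
have t2 : t * (1 - t) <= t by nra.
have t3 : t * (1 - t) <= 1 - t by nra.
have a2 : 0 < (1 - a) * a by nra.
rewrite /tent; case: ifP => _.
  apply: (@le_trans _ _ ((1 - a) * (t * (1 - t)))); last by rewrite ler_wpM2l//; lra.
  by rewrite ler_wpM2r//; nra.
apply: (@le_trans _ _ (a * (t * (1 - t)))); last by rewrite ler_wpM2l//; lra.
by rewrite ler_wpM2r//; nra.
Qed.

(** Tents with different peaks are comparable, so finiteness of [fseq] at one parameter gives it at
    all of them. *)
Lemma tent_le a b t : 0 < a < 1 -> 0 < b < 1 -> 0 <= t <= 1 ->
  tent a t <= (b * (1 - b))^-1 * tent b t.
Proof.
move=> /andP[a0 a1] /andP[b0 b1] /andP[t0 t1].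
have b2 : 0 < b * (1 - b) by nra.
rewrite mulrC ler_pdivlMr// {2}/tent; case: ifP => _.
  apply: (le_trans (ler_wpM2r (ltW b2) (tent_le_left _ _))).
  have h1 : 0 <= (1 - b) * t by nra.
  have h2 : (1 - a) * b <= 1 by nra.
  by have := ler_wpM2l h1 h2; lra.
apply: (le_trans (ler_wpM2r (ltW b2) (tent_le_right _ _))).
have h1 : 0 <= b * (1 - t) by nra.
have h2 : a * (1 - b) <= 1 by nra.
by have := ler_wpM2l h1 h2; lra.
Qed.

End Tent.

Section Fseq.
Variables (R : realType) (I : choiceType) (d : I -> R).
Hypothesis d01 : forall i, 0 <= d i <= 1.

Lemma fseq_tent (a : R) : 0 < a < 1 ->
  fseq d a = (\esum_(i in setT) (tent a (d i))%:E)%E.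
Proof.
move=> /andP[a0 a1]; rewrite (esumID [set i | d i < a]); last first.
  by move=> i _; apply: tent_ge0; rewrite ?a0.
rewrite !setTI /fseq -!esumZ ?ltW ?subr_gt0//; congr (_ + _)%E.
  by apply: eq_esum => i /= di; rewrite /tent di.
have -> : ~` [set i | d i < a] = [set i | a <= d i].
  by apply/seteqP; split=> i /= => [/negP|] ; rewrite leNgt// => /negP.
by apply: eq_esum => i /= di; rewrite /tent ltNge di.
Qed.

Lemma fseq_ge0 (a : R) : 0 < a < 1 -> (0 <= fseq d a)%E.
Proof.
move=> a01; rewrite fseq_tent//; apply: esum_ge0 => i _.
exact: tent_ge0.
Qed.

Hypothesis fd_fin : exists a : R, 0 < a < 1 /\ (fseq d a < +oo)%E.

Lemma fseq_fin (a : R) : 0 < a < 1 -> (fseq d a < +oo)%E.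
Proof.
have [b [b01 fb]] := fd_fin => a01; rewrite fseq_tent//.
apply: (@le_lt_trans _ _ (\esum_(i in setT) ((b * (1 - b))^-1 * tent b (d i))%:E)%E).
  by apply: le_esum => i _; rewrite lee_fin tent_le.
have b2 : 0 < b * (1 - b) by case/andP: b01 => *; nra.
rewrite esumZ ?invr_ge0 ?ltW// -fseq_tent//.
move: fb (fseq_ge0 b01); case: (fseq d b) => // r _ _.
by rewrite -EFinM ltry.
Qed.

Lemma fseq_fin_num (a : R) : 0 < a < 1 -> fseq d a \is a fin_num.
Proof. by move=> a01; rewrite ge0_fin_numE ?fseq_ge0 ?fseq_fin. Qed.

Lemma variance_fin : (\esum_(i in setT) (d i * (1 - d i))%:E < +oo)%E.
Proof.
have [b [b01 fb]] := fd_fin; have b2 : 0 < b * (1 - b) by case/andP: b01 => *; nra.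
have le : (\esum_(i in setT) (b * (1 - b) * (d i * (1 - d i)))%:E < +oo)%E.
  apply: le_lt_trans fb; rewrite fseq_tent//; apply: le_esum => i _.
  by rewrite lee_fin tent_ge.
move: le; rewrite esumZ ?ltW//.
case: (esum _ _) => [r _| |//]; first exact: ltry.
by rewrite mulry gtr0_sg// mul1e ltxx.
Qed.

(** Each such index contributes at least [c * c] to the convergent sum of [d i * (1 - d i)]; the
    values can accumulate only at 0 and 1. *)
Lemma finite_inner (c : R) : 0 < c < 1 -> finite_set [set i | c <= d i <= 1 - c].
Proof.
move=> /andP[c0 c1].
have c2 : 0 < c * c by rewrite mulr_gt0.
apply: sub_finite_set (esum_finite_ge (A := setT) _ c2 variance_fin).
  by move=> i /= /andP[h1 h2]; split => //=; nra.
by move=> i _; have /andP[h1 h2] := d01 i; rewrite mulr_ge0// subr_ge0.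
Qed.

Lemma near_level (a : R) : 0 < a < 1 -> (forall i, d i <> a) ->
  \forall x \near a, 0 < x < 1 /\ forall i, (d i < x) = (d i < a).
Proof.
(* With this [c] the point [a] is interior to [[c, 1 - c]]. Only finitely many [d i] lie in that
   interval, and each stays on its side of [x] for [x] near [a]; the others never meet the
   interval. *)
move=> /andP[a0 a1] da; pose c := Num.min a (1 - a) / 2.
have m0 : 0 < Num.min a (1 - a) by rewrite lt_min a0 subr_gt0.
have c0 : 0 < c by rewrite divr_gt0.
have ca : c < a by rewrite ltr_pdivrMr// gt_min; apply/orP; left; lra.
have c1a : a < 1 - c.
  by rewrite ltrBrDl -ltrBrDr ltr_pdivrMr// gt_min; apply/orP; right; lra.
have cfin : finite_set [set i | c <= d i <= 1 - c].
  by apply: finite_inner; rewrite c0; lra.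
have H : \forall x \near a, forall i, i \in finmap.enum_fset (fset_set [set i | c <= d i <= 1 - c]) ->
    (d i < x) = (d i < a).
  apply: filter_all_seq => i.
  have [da1|da1] := ltP (d i) a.
    by near=> x; near: x; exact: lt_nbhsr.
  have {}da1 : a < d i by rewrite lt_neqAle da1 andbT eq_sym; exact/eqP.
  near=> x; apply/negbTE; rewrite -leNgt ltW//; near: x.
  exact: lt_nbhsl.
near=> x.
have xc : c < x by near: x; exact: lt_nbhsr.
have xc1 : x < 1 - c by near: x; exact: lt_nbhsl.
split; first by apply/andP; split; lra.
move=> i; have [ci|ci] := boolP (c <= d i <= 1 - c).
  move: i ci; near: x; apply: filterS H => x H i ci; apply: H.
  by rewrite in_fset_set// inE.
rewrite negb_and -!ltNge in ci; case/orP: ci => ci.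
  by rewrite !(lt_trans ci).
by rewrite !ltNge !ltW ?(lt_trans _ ci).
Unshelve. all: by end_near. Qed.

Lemma countable_levels : countable [set a | 0 < a < 1 /\ exists i, d i = a].
Proof.
(* The shift by 2 keeps the cutoff strictly below 1, as [finite_inner] requires. *)
pose X n := [set i | n.+2%:R^-1 <= d i <= 1 - n.+2%:R^-1].
have cX : countable (\bigcup_n (d @` X n)).
  apply: bigcup_countable => // n _; apply/finite_set_countable/finite_image.
  by apply: finite_inner; rewrite invr_gt0 ltr0n/= invf_lt1// ltr1n.
apply: sub_countable cX; apply: subset_card_le => a [/andP[a0 a1] [i di]].
rewrite -{}di in a0 a1 *.
pose m := Num.min (d i) (1 - d i).
have m0 : 0 < m by rewrite lt_min a0 subr_gt0.
have mn : (Num.bound m^-1).+2%:R^-1 <= m.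
  rewrite -[leRHS]invrK lef_pV2 ?posrE ?invr_gt0 ?ltr0n//.
  apply: (le_trans (ltW (archi_boundP _))); first by rewrite invr_ge0 ltW.
  by rewrite ler_nat ltnW// ltnW.
exists (Num.bound m^-1) => //; exists i => //; rewrite /X /=.
by move: mn; rewrite /m le_min lerBrDl -lerBrDr => /andP[-> ->].
Qed.

End Fseq.

(** * Derivatives and doubly stochastic matrices *)

Lemma is_derive_affine (R : realType) (a A B : R) :
  is_derive a (1 : R) (fun x : R => (1 - x) * A + x * B) (B - A).
Proof.
rewrite (_ : (fun x : R => _) = (cst A + (B - A) \*: id)); last first.
  by apply/funext => x; rewrite !fctE /= -[_ *: _]/(_ * _); ring.
apply: is_derive_eq.
by rewrite add0r /GRing.scale /= mulr1.
Qed.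

Section Derivative.
Variables (R : realType) (I : choiceType) (d : I -> R).
Hypothesis d01 : forall i, 0 <= d i <= 1.
Hypothesis fd_fin : exists a : R, 0 < a < 1 /\ (fseq d a < +oo)%E.

Lemma fseq_parts (a : R) : 0 < a < 1 -> exists A B : R,
  (\esum_(i in [set i | d i < a]%R) (d i)%:E = A%:E)%E /\
  (\esum_(i in [set i | a <= d i]%R) (1 - d i)%:E = B%:E)%E.
Proof.
move=> a01; have := fseq_fin d01 fd_fin a01; rewrite /fseq.
have : (0 <= \esum_(i in [set i | d i < a]%R) (d i)%:E)%E.
  by apply: esum_ge0 => i _; rewrite lee_fin; case/andP: (d01 i).
have : (0 <= \esum_(i in [set i | a <= d i]%R) (1 - d i)%:E)%E.
  by apply: esum_ge0 => i _; rewrite lee_fin subr_ge0; case/andP: (d01 i).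
have [a0 a1] : 0 < a /\ 0 < 1 - a by case/andP: a01; rewrite subr_gt0.
case: (esum _ _) => [B| |//]; case: (esum _ _) => [A| |//] _ _.
- by exists A, B.
- by rewrite gt0_muley ?lte_fin.
- by rewrite [(a%:E * _)%E]gt0_muley ?lte_fin// addey.
- by rewrite !gt0_muley ?lte_fin.
Qed.

(** Near [a] the two index sets do not change, so [fseq d] is affine there. *)
Lemma fseq_derivative (a A B : R) : 0 < a < 1 -> (forall i, d i <> a) ->
  (\esum_(i in [set i | d i < a]%R) (d i)%:E = A%:E)%E ->
  (\esum_(i in [set i | a <= d i]%R) (1 - d i)%:E = B%:E)%E ->
  has_derivative (fseq d) a (B - A).
Proof.
move=> a01 da AE BE.
have nearE : \forall x \near a, fseq d x = ((1 - x) * A + x * B)%:E.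
  apply: filterS (near_level d01 fd_fin a01 da) => x [_ Hx].
  rewrite /fseq (_ : [set i | d i < x] = [set i | d i < a]); last first.
    by apply/seteqP; split=> i /=; rewrite Hx.
  rewrite (_ : [set i | x <= d i] = [set i | a <= d i]) ?AE ?BE//.
  by apply/seteqP; split=> i /=; rewrite !leNgt Hx.
split; first by apply: filterS nearE => x ->.
apply: (@near_eq_is_derive _ _ _ (fun x : R => (1 - x) * A + x * B)).
  by apply: filterS nearE => x /= ->.
exact: is_derive_affine.
Qed.

End Derivative.

Section Transport.
Variables (R : realType) (I : choiceType).
Implicit Types (p : I -> I -> R) (d l : I -> R).

(** A doubly stochastic matrix carrying [l] to [d]; it will be the matrix of squared inner products
    of [e] with an eigenbasis. *)
Definition transport p d l : Prop :=
  [/\ forall i j, 0 <= p i j,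
      forall i, (\esum_(j in setT) (p i j)%:E = 1)%E,
      forall j, (\esum_(i in setT) (p i j)%:E = 1)%E,
      forall j, 0 <= l j <= 1
    & forall i, (\esum_(j in setT) (p i j * l j)%:E = (d i)%:E)%E].

(** The reflection [t |-> 1 - t], through which results at the endpoint 0 give those at the endpoint
    1. *)
Lemma transport_opp p d l : transport p d l ->
  transport p (fun i => 1 - d i) (fun j => 1 - l j).
Proof.
move=> [p0 pr pc l01 dl]; split => // [j|i].
  by have /andP[h1 h2] := l01 j; apply/andP; split; lra.
have := pr i; rewrite (_ : (fun j => (p i j)%:E) =
  (fun j => (p i j * l j)%:E + (p i j * (1 - l j))%:E)%E); last first.
  by apply/funext => j; rewrite -EFinD -mulrDr addrC subrK mulr1.
have l0 j : 0 <= p i j * l j by rewrite mulr_ge0//; case/andP: (l01 j).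
have l1 j : 0 <= p i j * (1 - l j).
  by rewrite mulr_ge0// subr_ge0; case/andP: (l01 j).
rewrite (@esumD _ _ setT (fun j => (p i j * l j)%:E)
  (fun j => (p i j * (1 - l j))%:E)) => [|j _|j _]; [|exact: l0|exact: l1].
rewrite dl.
case: (\esum_(j in _) (p i j * (1 - l j))%:E)%E => [x| |//] //.
by move=> /eqP; rewrite -EFinD eqe => /eqP h; congr EFin; lra.
Qed.

Variables (p : I -> I -> R) (d l : I -> R).
Hypothesis pdl : transport p d l.

Lemma transport_bounds i : 0 <= d i <= 1.
Proof.
have ge0 p' d' l' : transport p' d' l' -> 0 <= d' i.
  move=> [p0 _ _ l01 dl]; rewrite -lee_fin -dl; apply: esum_ge0 => j _.
  by rewrite lee_fin mulr_ge0//; case/andP: (l01 j).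
by rewrite (ge0 _ _ _ pdl) -subr_ge0 (ge0 _ _ _ (transport_opp pdl)).
Qed.

(** In the application, the squared norm of the projection of [e i] onto [ker E]. *)
Definition null_mass i : \bar R := (\esum_(j in [set j | l j = 0%R]) (p i j)%:E)%E.

Lemma null_mass_ge0 i : (0 <= null_mass i)%E.
Proof. by case: pdl => p0 *; apply: esum_ge0 => j _; rewrite lee_fin. Qed.

Lemma esum_null_mass : (\esum_(i in setT) null_mass i = counting [set j | l j = 0%R])%E.
Proof.
case: pdl => p0 pr pc l01 dl.
rewrite exchange_esum -?esum_cst1; last by move=> *; rewrite lee_fin.
by apply: eq_esum => j _; rewrite pc.
Qed.

Lemma null_mass_le1 i : (null_mass i <= 1)%E.
Proof.
case: pdl => p0 pr pc l01 dl; rewrite -(pr i) (esumID [set j | l j = 0]).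
  by rewrite setTI leeDl//; apply: esum_ge0 => j _; rewrite lee_fin.
by move=> j _; rewrite lee_fin.
Qed.

(** If [d i = 0], all the nonnegative terms [p i j * l j] vanish, so row [i] is supported on
    [l = 0]. *)
Lemma null_mass1 i : d i = 0 -> null_mass i = 1%E.
Proof.
case: pdl => p0 pr pc l01 dl di; rewrite -(pr i) (esumID [set j | l j = 0] setT).
  rewrite setTI [X in (_ + X)%E]esum1 ?adde0// => j [_ /= /eqP lj].
  apply/eqP; rewrite eqe; apply/eqP.
  have pl k : (0 <= (p i k * l k)%:E)%E.
    by rewrite lee_fin mulr_ge0//; case/andP: (l01 k).
  have := @esum_seq_ge _ _ setT (fun k => (p i k * l k)%:E) [:: j] isT (fun _ _ => Logic.I).
  rewrite big_seq1 dl di => le0; have /eqP : (p i j * l j)%:E = 0%E.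
    by apply/eqP; rewrite eq_le le0 pl.
  by rewrite eqe mulf_eq0 (negbTE lj) orbF => /eqP.
by move=> j _; rewrite lee_fin.
Qed.

Lemma counting_null_le :
  (counting [set i | d i = 0%R] <= counting [set j | l j = 0%R] :> \bar R)%E.
Proof.
rewrite -esum_null_mass (esumID [set i | d i = 0]); last first.
  by move=> *; exact: null_mass_ge0.
rewrite setTI -esum_cst1; apply: (@le_trans _ _ (\esum_(i in [set i | d i = 0%R]) null_mass i)%E).
  by apply: le_esum => i /= di; rewrite null_mass1.
by rewrite leeDl//; apply: esum_ge0 => *; exact: null_mass_ge0.
Qed.

(** Jensen's inequality: row [i] averages each of the two affine functions exactly, and the tent
    lies below both. *)
Lemma transport_tent (a : R) i : 0 < a < 1 ->
  (\esum_(j in setT) (p i j * tent a (l j))%:E <= (tent a (d i))%:E)%E.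
Proof.
case: pdl => p0 pr pc l01 dl /andP[a0 a1]; rewrite tentE EFin_min le_min.
have [_ _ _ _ dl'] := transport_opp pdl.
have b0 : 0 <= 1 - a by rewrite subr_ge0 ltW.
have {a1}a2 := ltW a0; apply/andP; split; rewrite EFinM.
  rewrite -dl -esumZ//; apply: le_esum => j _; rewrite lee_fin.
  by rewrite mulrCA ler_wpM2l// tent_le_left.
rewrite -dl' -esumZ//; apply: le_esum => j _; rewrite lee_fin.
by rewrite mulrCA ler_wpM2l// tent_le_right.
Qed.

Lemma fseq_rows (a : R) : 0 < a < 1 ->
  (fseq l a = \esum_(i in setT) \esum_(j in setT) (p i j * tent a (l j))%:E)%E.
Proof.
case: pdl => p0 pr pc l01 dl a01; rewrite fseq_tent// exchange_esum; last first.
  by move=> *; rewrite lee_fin mulr_ge0// tent_ge0.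
apply: eq_esum => j _; under eq_esum do rewrite mulrC.
by rewrite esumZ ?tent_ge0// pc mule1.
Qed.

Lemma transport_fseq_le (a : R) : 0 < a < 1 -> (fseq l a <= fseq d a)%E.
Proof.
move=> a01; rewrite fseq_rows// fseq_tent//; last exact: transport_bounds.
by apply: le_esum => i _; exact: transport_tent.
Qed.

(** For [a <= d i] the right side is the row average of [a * (1 - l j)]. Where [l j = 0] this is [a]
    while the tent is 0, which leaves the surplus [a * null_mass]. *)
Lemma transport_tent_null (a : R) i : 0 < a < 1 -> a <= d i ->
  (a%:E * null_mass i + \esum_(j in setT) (p i j * tent a (l j))%:E
    <= (tent a (d i))%:E)%E.
Proof.
case: pdl => p0 pr pc l01 dl a01 adi; have /andP[a0 a1] := a01.
have [_ _ _ _ dl'] := transport_opp pdl.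
have pt0 j : (0 <= (p i j * tent a (l j))%:E)%E.
  by rewrite lee_fin mulr_ge0// tent_ge0.
have ap0 j : (0 <= (a * (p i j * (1 - l j)))%:E)%E.
  have l1 : 0 <= 1 - l j by rewrite subr_ge0; case/andP: (l01 j).
  by rewrite lee_fin !mulr_ge0// ltW.
have a2 := ltW a0; rewrite /tent ltNge adi /= EFinM -dl' -[leRHS]esumZ//.
rewrite (esumID [set j | l j = 0] setT)// [leRHS](esumID [set j | l j = 0] setT)//.
rewrite !setTI [X in (_ + (X + _))%E]esum1 ?add0e; last first.
  by move=> j /= ->; rewrite a0 mulr0 mulr0.
apply: leeD.
  rewrite /null_mass -esumZ//; apply: le_esum => j /= ->.
  by rewrite subr0 mulr1.
apply: le_esum => j _; rewrite lee_fin mulrCA ler_wpM2l//.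
exact: tent_le_right.
Qed.

Lemma fseq_gap (a : R) (s : seq I) : 0 < a < 1 -> uniq s ->
  (forall i, i \in s -> a <= d i) ->
  (a%:E * (\sum_(i <- s) null_mass i) + fseq l a <= fseq d a)%E.
Proof.
case: (pdl) => p0 pr pc l01 dl a01 us sa; have /andP[a0 a1] := a01.
rewrite fseq_rows// fseq_tent//; last exact: transport_bounds.
pose m i := if i \in s then null_mass i else 0%E.
have -> : (a%:E * (\sum_(i <- s) null_mass i) = \esum_(i in setT) (a%:E * m i))%E.
  rewrite (esumID [set` s]); last first.
    move=> i _; rewrite /m; case: ifP => _; last by rewrite mule0.
    by rewrite mule_ge0 ?null_mass_ge0// lee_fin ltW.
  rewrite [X in (_ + X)%E]esum1 ?adde0; last first.
    by move=> i [_ /= /negP is_]; rewrite /m (negbTE is_) mule0.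
  rewrite setTI esum_fset//; last first.
    move=> i; rewrite /m; case: ifP => _ _; last by rewrite mule0.
    by rewrite mule_ge0 ?null_mass_ge0// lee_fin ltW.
  rewrite -fsbig_seq// ge0_sume_distrr//; last by move=> *; exact: null_mass_ge0.
  by rewrite !big_seq; apply: eq_bigr => i is_; rewrite /m is_.
rewrite -esumD; last 2 first.
- move=> i _; rewrite /m; case: ifP => _; last by rewrite mule0.
  by rewrite mule_ge0 ?null_mass_ge0// lee_fin ltW.
- move=> i _; apply: esum_ge0 => j _.
  by rewrite lee_fin mulr_ge0// tent_ge0.
apply: le_esum => i _; rewrite /m; case: ifPn => is_.
  by apply: transport_tent_null => //; exact: sa.
by rewrite mule0 add0e transport_tent.
Qed.

Hypothesis fd_fin : exists a : R, 0 < a < 1 /\ (fseq d a < +oo)%E.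

Lemma fseq_quotient (a : R) (s : seq I) : 0 < a < 1 -> uniq s ->
  (forall i, i \in s -> a <= d i) ->
  (\sum_(i <- s) null_mass i <= (fseq d a - fseq l a) * (a^-1)%:E)%E.
Proof.
case: (pdl) => p0 pr pc l01 dl a01 us sa; have /andP[a0 a1] := a01.
have fd := fseq_fin_num transport_bounds fd_fin a01.
have fl : fseq l a \is a fin_num.
  rewrite ge0_fin_numE ?fseq_ge0//; apply: (le_lt_trans (transport_fseq_le a01)).
  by rewrite ltey_eq fd.
by rewrite lee_pdivlMr// muleC leeBrDr// fseq_gap.
Qed.

End Transport.

Lemma limf_einf_ge (R : realType) (f : R -> \bar R) (F : set_system R) (V : set R)
    (m : \bar R) : F V -> (forall x, V x -> m <= f x)%E -> (m <= limf_einf f F)%E.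
Proof.
move=> FV mf; rewrite /limf_einf leeNr /limf_esup.
apply: (@le_trans _ _ (ereal_sup ((\- f)%E @` V))).
  by apply: ereal_inf_lbound; exists V.
by apply: ge_ereal_sup => _ [x Vx <-]; rewrite leeN2 mf.
Qed.

Section TransportLimits.
Variables (R : realType) (I : choiceType) (p : I -> I -> R) (d l : I -> R).
Hypothesis pdl : transport p d l.

(** The count of zeros of [l] is the total null mass; rows with [d i = 0] carry at most 1 each, and
    the other rows are bounded through finite subsums. *)
Lemma counting_null_ge (L : \bar R) :
  (forall s, uniq s -> (forall i, i \in s -> d i != 0) ->
     (\sum_(i <- s) null_mass p l i <= L)%E) ->
  (counting [set j | l j = 0%R] <= counting [set i | d i = 0%R] + L)%E.
Proof.
move=> HL; rewrite -(esum_null_mass pdl) (esumID [set i | d i = 0]); last first.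
  by move=> *; exact: null_mass_ge0 pdl _.
rewrite !setTI -esum_cst1; apply: leeD.
  by apply: le_esum => i _; exact: null_mass_le1 pdl _.
apply: esum_seq_le => s us sd; apply: HL => // i /sd /=.
by move=> /eqP.
Qed.

Hypothesis fd_fin : exists a : R, 0 < a < 1 /\ (fseq d a < +oo)%E.

Lemma counting_null_liminf :
  (counting [set j | l j = 0%R] <= counting [set i | d i = 0%R] +
    limf_einf (fun a : R => (fseq d a - fseq l a) * (a^-1)%:E) 0%R^'+)%E.
Proof.
apply: counting_null_ge => s us sd.
(* The finitely many nonzero [d i] with [i] in [s] all exceed [a] or equal it once [a] is small. *)
apply: (@limf_einf_ge _ _ _ [set a | 0 < a < 1 /\ forall i, i \in s -> d i != 0 -> a <= d i]).
  apply: filterI.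
    near=> a => /=; apply/andP; split; near: a; [exact: nbhs_right_gt|exact: nbhs_right_lt].
  apply: filter_all_seq => i; have /andP[di0 _] := transport_bounds pdl i.
  have [di|di] := eqVneq (d i) 0; first exact: filterE.
  have di1 : 0 < d i by rewrite lt_neqAle eq_sym di.
  by apply: filterS (nbhs_right_le di1) => a /=.
move=> a [a01 sa]; apply: (fseq_quotient pdl fd_fin a01 us) => i is_.
by apply: sa => //; exact: sd.
Unshelve. all: by end_near. Qed.

End TransportLimits.

Section TransportOpp.
Variables (R : realType) (I : choiceType) (p : I -> I -> R) (d l : I -> R).
Hypothesis pdl : transport p d l.
Hypothesis fd_fin : exists a : R, 0 < a < 1 /\ (fseq d a < +oo)%E.

(** Reflection exchanges the strict and the weak inequality in [fseq], which is harmless because the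
    branches of the tent agree at the threshold. *)
Lemma fseq_opp (f : I -> R) (a : R) : (forall i, 0 <= f i <= 1) -> 0 < a < 1 ->
  fseq (fun i => 1 - f i) (1 - a) = fseq f a.
Proof.
move=> f01 /andP[a0 a1]; rewrite !fseq_tent ?a0//.
- by apply: eq_esum => i _; rewrite tent_sym.
- by move=> i; have /andP[? ?] := f01 i; apply/andP; split; lra.
- by apply/andP; split; lra.
Qed.

Lemma set_opp1 (f : I -> R) : [set i | 1 - f i = 0] = [set i | f i = 1].
Proof. by apply/seteqP; split=> i /= h; lra. Qed.

Lemma counting_one_le :
  (counting [set i | d i = 1%R] <= counting [set j | l j = 1%R] :> \bar R)%E.
Proof. by have := counting_null_le (transport_opp pdl); rewrite !set_opp1. Qed.

Lemma counting_one_liminf :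
  (counting [set j | l j = 1%R] <= counting [set i | d i = 1%R] +
    limf_einf (fun a : R => (fseq d a - fseq l a) * ((1 - a)^-1)%:E) 1%R^'-)%E.
Proof.
have pdl' := transport_opp pdl; have d01 := transport_bounds pdl.
have l01 : forall j, 0 <= l j <= 1 by case: pdl.
rewrite -!set_opp1; apply: (counting_null_ge pdl') => s us sd.
apply: (@limf_einf_ge _ _ _
    [set a | 0 < a < 1 /\ forall i, i \in s -> 1 - d i != 0 -> a >= d i]).
  apply: filterI.
    near=> a => /=; apply/andP; split; near: a; [exact: nbhs_left_gt|exact: nbhs_left_lt].
  apply: filter_all_seq => i; have /andP[_ di1] := d01 i.
  have [di|di] := eqVneq (1 - d i) 0; first exact: filterE.
  have di2 : d i < 1 by rewrite lt_neqAle di1 andbT eq_sym -subr_eq0.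
  by apply: filterS (nbhs_left_ge di2) => a /=.
move=> a [a01 sa]; rewrite -(fseq_opp d01)// -(fseq_opp l01)//.
apply: (fseq_quotient pdl') => //.
- have [b [b01 fb]] := fd_fin; exists (1 - b); rewrite fseq_opp//; split => //.
  by case/andP: b01 => *; apply/andP; split; lra.
- by case/andP: a01 => *; apply/andP; split; lra.
- by move=> i is_; rewrite lerD2l lerN2; apply: sa => //; exact: sd.
Unshelve. all: by end_near. Qed.

Let block (X Y : set I) (w : I -> R) : \bar R :=
  (\esum_(i in X) \esum_(j in Y) (p i j * w j)%:E)%E.

(** Split all four sums into blocks along [S] and [T]. The blocks with weight [l] on [~S x ~T] and
    with weight [1 - l] on [S x T] cancel; on the two off-diagonal blocks the weights [l] and
    [1 - l] add up to 1. *)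
Lemma transport_difference (S T : set I) (Ad Bd Al Bl : R) :
  (\esum_(i in ~` S) (d i)%:E = Ad%:E)%E -> (\esum_(i in S) (1 - d i)%:E = Bd%:E)%E ->
  (\esum_(j in ~` T) (l j)%:E = Al%:E)%E -> (\esum_(j in T) (1 - l j)%:E = Bl%:E)%E ->
  exists x y : R, [/\ (\esum_(i in ~` S) \esum_(j in T) (p i j)%:E = x%:E)%E,
    (\esum_(i in S) \esum_(j in ~` T) (p i j)%:E = y%:E)%E
    & (Bd - Ad) - (Bl - Al) = y - x].
Proof.
case: (pdl) => p0 pr pc l01 dl; have [_ _ _ l01' dl'] := transport_opp pdl.
have pw0 (w : I -> R) i j : (forall j, 0 <= w j <= 1) -> (0 <= (p i j * w j)%:E)%E.
  by move=> w01; rewrite lee_fin mulr_ge0//; case/andP: (w01 j).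
have b0 X Y w : (forall j, 0 <= w j <= 1) -> (0 <= block X Y w)%E.
  by move=> w01; apply: esum_ge0 => i _; apply: esum_ge0 => j _; exact: pw0.
have row X (w D : I -> R) : (forall j, 0 <= w j <= 1) ->
    (forall i, (\esum_(j in setT) (p i j * w j)%:E = (D i)%:E)%E) ->
    (\esum_(i in X) (D i)%:E = block X T w + block X (~` T) w)%E.
  move=> w01 wD; rewrite /block -esumD => [|i _|i _]; last 2 first.
  - by apply: esum_ge0 => j _; exact: pw0.
  - by apply: esum_ge0 => j _; exact: pw0.
  apply: eq_esum => i _; rewrite -wD (esumID T) ?setTI//.
  by move=> j _; exact: pw0.
have col Y w : (forall j, 0 <= w j <= 1) ->
    (\esum_(j in Y) (w j)%:E = block S Y w + block (~` S) Y w)%E.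
  move=> w01; transitivity (block setT Y w); last first.
    rewrite /block (esumID S) ?setTI// => i _.
    by apply: esum_ge0 => j _; exact: pw0.
  rewrite /block exchange_esum; last by move=> *; exact: pw0.
  apply: eq_esum => j _; under eq_esum do rewrite mulrC.
  by rewrite esumZ ?pc ?mule1//; case/andP: (w01 j).
have full X Y : (\esum_(i in X) \esum_(j in Y) (p i j)%:E =
    block X Y l + block X Y (fun j => (1 - l j)%R))%E.
  rewrite /block -esumD => [|i _|i _]; last 2 first.
  - by apply: esum_ge0 => j _; exact: (pw0 l).
  - by apply: esum_ge0 => j _; exact: (pw0 _ _ _ l01').
  apply: eq_esum => i _; rewrite -esumD => [|j _|j _]; [|exact: (pw0 l)|exact: (pw0 _ _ _ l01')].
  by apply: eq_esum => j _; rewrite -EFinD -mulrDr addrC subrK mulr1.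
rewrite (row _ _ _ l01 dl) (row _ _ _ l01' dl') (col _ _ l01) (col _ _ l01') !full.
have fin (x y : \bar R) (z : R) : (0 <= x)%E -> (0 <= y)%E -> (x + y)%E = z%:E ->
    exists u v : R, [/\ x = u%:E, y = v%:E, z = u + v, (0 <= u%:E)%E & (0 <= v%:E)%E].
  case: x => [u| |//]; case: y => [v| |//]// v0 u0.
  by move=> /eqP; rewrite -EFinD eqe => /eqP <-; exists u, v.
move=> /fin[||a1 [a2 [-> -> -> _ a20]]]; try exact: b0.
move=> /fin[||b1 [b2 [-> -> -> b10 _]]]; try exact: b0.
move=> /fin[||a3 [a2' [-> [<-] -> _ _]]] //; try exact: b0.
move=> /fin[||b1' [b3 [[<-] -> -> _ _]]] //; try exact: b0.
exists (a1 + b3), (a3 + b2); split; rewrite -?EFinD//; ring.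
Qed.

End TransportOpp.

(** * The quadratic form in an eigenbasis *)

Section EigenSum.
Variables (R : realType) (V : completeNormedModType R[i]).
Variable dot : {dot V for Num.conj}.
Hypothesis Vdot : induces_norm dot.
Variable E : {linear V -> V}.
Hypothesis sE : symmetric_op dot E.
Local Notation t := (qform dot E).
Local Notation q := (sqnorm dot).
Hypothesis tE : forall x, 0 <= t x <= q x.
Variables (I : choiceType) (v : I -> V) (l : I -> R).
Hypothesis ov : orthonormal_family dot setT v.
Hypothesis tv : setT `<=` closure (linear_span setT v).
Hypothesis Ev : forall j, E (v j) = (l j)%:C *: v j.

Lemma eigenvalue_qform j : l j = t (v j).
Proof. by rewrite /qform Ev dotZl ov// eqxx mulr1. Qed.

Lemma eigenvalue_bounds j : 0 <= l j <= 1.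
Proof.
have := tE (v j); rewrite -eigenvalue_qform.
by rewrite [q (v j)]/sqnorm ov// eqxx.
Qed.

(** [E] maps the partial sum into the span of the [v j] with [j] in [s], which is orthogonal to the
    remainder, so the cross terms combine. *)
Lemma qform_eigen_rem (x : V) (s : seq I) : uniq s ->
  t (x - fourier_sum dot v x s) = t x - \sum_(j <- s) sqmod (dot x (v j)) * l j.
Proof.
move=> us; set z := fourier_sum _ _ _ _; set n := \sum_(j <- s) _.
have Ezw w : dot (E z) w = \sum_(j <- s) dot x (v j) * (l j)%:C * dot (v j) w.
  rewrite /z /fourier_sum linear_sum dot_suml; apply: eq_bigr => j _.
  by rewrite linearZ /= Ev !dotZl mulrA.
have Ezx : dot (E z) x = n%:C.
  rewrite Ezw rmorph_sum /=; apply: eq_bigr => j _.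
  by rewrite (dotC _ x (v j)) mulrAC mulcJ -rmorphM.
have Ezy : dot (E z) (x - z) = 0.
  rewrite Ezw big1_seq// => j /= js.
  by rewrite (dotC _ (x - z)) (dot_fourier_rem ov) ?conjc0 ?mulr0.
have Ezz : dot (E z) z = n%:C.
  by move: Ezy; rewrite dotBr Ezx => /eqP; rewrite subr_eq0 => /eqP.
have Exz : dot (E x) z = n%:C by rewrite sE dotC Ezx conjc_real.
by rewrite /qform (symB sE) dotBl !dotBr Ezx Ezz Exz !(ReD, ReN) /=; ring.
Qed.

(** The upper bound is [t >= 0] on remainders; the lower bound is [t <= q] on remainders, which tend
    to 0 by Parseval. *)
Lemma qform_eigen_sum x :
  (\esum_(j in setT) (sqmod (dot x (v j)) * l j)%:E = (t x)%:E)%E.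
Proof.
apply/eqP; rewrite eq_le; apply/andP; split.
  apply: esum_seq_le => s us _; rewrite sumEFin lee_fin -subr_ge0.
  by rewrite -qform_eigen_rem//; case/andP: (tE (x - fourier_sum dot v x s)).
apply/lee_addgt0Pr => e e0.
have cx : closure (linear_span setT v) x by exact: tv.
have /esum_seq_gt[s [us _ Hs]] :
    ((q x - e)%:E < \esum_(j in setT) (sqmod (dot x (v j)))%:E)%E.
  by rewrite (parseval Vdot ov cx) lte_fin ltrBlDr ltrDl.
rewrite sumEFin lte_fin in Hs.
apply: le_trans (leeD2r _ (esum_seq_ge _ us (fun _ _ => Logic.I))).
rewrite sumEFin -EFinD lee_fin.
have /andP[_] := tE (x - fourier_sum dot v x s).
by rewrite qform_eigen_rem// (sqnorm_fourier_rem ov us)//; lra.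
Qed.

End EigenSum.

Lemma negligible_countable (R : realType) (A : set R) :
  countable A -> lebesgue_measure.-negligible A.
Proof.
move=> cA; apply/negligibleP; last exact: countable_lebesgue_measure0.
by apply: countable_measurable => // x; exact: measurable_set1.
Qed.

(** Glue the bases of the eigenspaces, taking at index [j] the one for the eigenvalue [l j];
    symmetry makes different eigenspaces orthogonal. *)
Lemma eigenvalue_list_basis (R : realType) (V : completeNormedModType R[i])
    (dot : {dot V for Num.conj}) (Vdot : induces_norm dot) (E : {linear V -> V})
    (sE : symmetric_op dot E) (I : choiceType) (l : I -> R) :
  diagonalizable_operator dot E -> eigenvalue_list dot E (fun j => (l j)%:C) ->
  exists v : I -> V, [/\ orthonormal_family dot setT v,
    setT `<=` closure (linear_span setT v) & forall j, E (v j) = (l j)%:C *: v j].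
Proof.
move=> [J [u [[_ ou tu] Eu]]] /choice[w Hw].
pose v j := w (l j)%:C j.
have Ev j : E (v j) = (l j)%:C *: v j by have [kv _ _] := Hw (l j)%:C; exact: kv.
have ov : orthonormal_family dot setT v.
  move=> j k _ _; have [ljk|ljk] := eqVneq (l j) (l k).
    by have [_ ow _] := Hw (l j)%:C; rewrite /v -ljk; apply: ow => //=; rewrite ljk.
  have -> : j == k = false by apply: contra_neqF ljk => /eqP ->.
  have := sE (v j) (v k); rewrite !Ev dotZl dotZr conjc_real => /eqP.
  rewrite -subr_eq0 -mulrBl mulf_eq0 -rmorphB /= => /orP[|/eqP //].
  by rewrite eq_complex /= eqxx andbT subr_eq0 (negbTE ljk).
exists v; split => //.
apply: (total_span Vdot ov) => // x _ ox.
(* A vector orthogonal to all [v j] is orthogonal to every eigenspace, hence to the diagonalizing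
   basis [u]. *)
apply: (@span_total _ _ _ Vdot J setT u x); first exact: tu.
move=> j _; have [mu Euj] := Eu j; have [_ _ tw] := Hw mu.
rewrite dotC (span_ortho Vdot _ (tw _ Euj)) ?conjc0// => i /= li.
by rewrite dotC -li ox ?conjc0.
Qed.

Theorem theorem12p1 (R : realType) (V : completeNormedModType R[i])
    (dot : {dot V for Num.conj})
    (Vdot : induces_norm dot) (Vsep : separable_space V)
    (E : {linear V -> V})
    (Epos : positive_operator dot E)
    (Espec : forall z : R[i], spectrum E z -> 0 <= z <= 1)
    (I : choiceType) (e : I -> V)
    (eonb : orthonormal_basis dot [set: V] [set: I] e)
    (d : I -> R) (dE : forall i, (d i)%:C = dot (E (e i)) (e i))
    (fd_fin : exists alpha : R, 0 < alpha < 1 /\ (fseq d alpha < +oo)%E) :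
  diagonalizable_operator dot E /\
  forall lam : I -> R, eigenvalue_list dot E (fun j => (lam j)%:C) ->
    [/\ forall alpha : R, 0 < alpha < 1 -> (fseq lam alpha <= fseq d alpha)%E,
        {ae lebesgue_measure, forall alpha : R, 0 < alpha < 1 ->
          exists dd dl : R,
            [/\ has_derivative (fseq d) alpha dd,
                has_derivative (fseq lam) alpha dl
              & exists k : int, dd - dl = k%:~R]},
        (counting [set j | lam j = 0%R] <=
           counting [set i | d i = 0%R] +
           limf_einf (fun alpha : R =>
             (fseq d alpha - fseq lam alpha) * (alpha^-1)%:E) 0%R^'+)%E /\
        (counting [set i | d i = 0%R] <= counting [set j | lam j = 0%R]
           :> \bar R)%E
      & (counting [set j | lam j = 1%R] <=
           counting [set i | d i = 1%R] +
           limf_einf (fun alpha : R =>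
             (fseq d alpha - fseq lam alpha) * ((1 - alpha)^-1)%:E) 1%R^'-)%E /\
        (counting [set i | d i = 1%R] <= counting [set j | lam j = 1%R]
           :> \bar R)%E].
Proof.
have [_ oe te] := eonb; have sE := positive_sym Epos.
have tE x : 0 <= qform dot E x <= sqnorm dot x.
  by rewrite positive_qform_ge0// contraction_qform_le.
have dq i : d i = qform dot E (e i).
  by apply: complexI; rewrite dE dot_qform.
have qe i : sqnorm dot (e i) = 1 by rewrite /sqnorm oe// eqxx.
have d01 i : 0 <= d i <= 1 by rewrite dq -(qe i) tE.
have diagE : diagonalizable_operator dot E.
  apply: (contraction_diagonalizable Vdot Epos Espec (I := I) (e := e)) => //.
  under eq_esum do rewrite -dq.
  exact: variance_fin d01 fd_fin.
split => // l lE.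
have [v [ov tv Ev]] := eigenvalue_list_basis Vdot sE diagE lE.
have ofe : orthonormal_family dot setT e by move=> i j _ _; exact: oe.
have qv j : sqnorm dot (v j) = 1 by rewrite /sqnorm ov// eqxx.
pose p i j := sqmod (dot (e i) (v j)).
have pdl : transport p d l.
  split.
  - by move=> i j; exact: sqmod_ge0.
  - move=> i; have ci : closure (linear_span setT v) (e i) by exact: tv.
    by rewrite (parseval Vdot ov ci) qe.
  - move=> j; have cj : closure (linear_span setT e) (v j) by exact: te.
    rewrite -[1%E]/(1%R%:E) -(qv j) -(parseval Vdot ofe cj).
    by apply: eq_esum => i _; rewrite /p dotC sqmodJ.
  - by apply: (eigenvalue_bounds (dot := dot) tE (v := v)) => // j; exact: Ev.
  - by move=> i; rewrite dq (qform_eigen_sum Vdot sE tE ov tv Ev).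
have l01 : forall j, 0 <= l j <= 1 by case: pdl.
have le_fseq a : 0 < a < 1 -> (fseq l a <= fseq d a)%E.
  by move=> a01; exact: (transport_fseq_le pdl).
have fl_fin : exists a : R, 0 < a < 1 /\ (fseq l a < +oo)%E.
  have [a [a01 fa]] := fd_fin; exists a; split => //.
  by apply: le_lt_trans fa; exact: le_fseq.
split => //; last 2 first.
- split; first exact: counting_null_liminf pdl fd_fin.
  exact: counting_null_le pdl.
- split; first exact: counting_one_liminf pdl fd_fin.
  exact: counting_one_le pdl.
(* The exceptional parameters are the values of [d] and of [l] in the open unit interval. *)
apply: negligibleS (negligibleU
  (negligible_countable (countable_levels d01 fd_fin))
  (negligible_countable (countable_levels l01 fl_fin))).
move=> a /= Ha; apply: contrapT => /not_orP[da la]; apply: Ha => a01.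
have {}da i : d i <> a by move=> di; apply: da; split => //; exists i.
have {}la j : l j <> a by move=> lj; apply: la; split => //; exists j.
have [Ad [Bd [AdE BdE]]] := fseq_parts d01 fd_fin a01.
have [Al [Bl [AlE BlE]]] := fseq_parts l01 fl_fin a01.
exists (Bd - Ad), (Bl - Al); split.
- exact: (fseq_derivative d01).
- exact: (fseq_derivative l01).
have below (f : I -> R) : [set i | f i < a] = ~` [set i | a <= f i].
  by apply/seteqP; split=> i /=; rewrite ltNge => /negP.
rewrite below in AdE; rewrite below in AlE.
have [x [y [xE yE ->]]] := transport_difference pdl AdE BdE AlE BlE.
have [k kE] := kadison_integer Vdot ofe ov te tv xE yE.
by exists (- k); rewrite intrN -kE opprB.
Qed.
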